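(* Let $\tilde P_n=\{\mathbf U_1,\dots,\mathbf U_n\}\subseteq[0,1)^s$, $n=b^m$, be a scrambled $(0,m,s)$-net in base $b$ and let $f\in L^2([0,1)^s)$. Then $$\mathrm{Cov}(f(\mathbf U_I),f(\mathbf U_J))=\sum_{\mathbf 0\neq\mathbf l\in\mathbb N^s}|\hat f(\mathbf l)|^2\,\hat\psi(\mathbf l)=\sum_{\mathbf 0\neq\mathbf k\in\mathbb N^s}\sigma_{\mathbf k}^2(f)\,\hat\psi_{\mathbf k}.$$
   Context: $\mathbb N=\{0,1,2,\dots\}$; $b$ is a prime, $s,m\ge1$ are integers, $n=b^m$. Nets. For $\mathbf k\in\mathbb N^s$, a set of $n=b^m$ points in $[0,1)^s$ is $\mathbf k$-equidistributed in base $b$ if every interval $\prod_{j=1}^s[a_jb^{-k_j},(a_j+1)b^{-k_j})$ with $a_j\in\{0,\dots,b^{k_j}-1\}$ contains exactly $b^{m-k_1-\cdots-k_s}$ of the points. It is a $(0,m,s)$-net in base $b$ if it is $\mathbf k$-equidistributed for all $\mathbf k\in\mathbb N^s$ with $k_1+\cdots+k_s\le m$. Common digits. For $x,y\in[0,1)$, $\gamma_b(x,y)$ is the number of initial common base $b$ digits of $x$ and $y$ (using finite expansions whenever possible), i.e. the $i$ with $\lfloor b^ix\rfloor=\lfloor b^iy\rfloor$ and $\lfloor b^{i+1}x\rfloor\ne\lfloor b^{i+1}y\rfloor$ ($\infty$ if $x=y$). For $\mathbf i\in\mathbb N^s$, $D_{\mathbf i}^s=\{(\mathbf x,\mathbf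 y)\in[0,1)^{2s}:\gamma_b(x_j,y_j)=i_j,\ j=1,\dots,s\}$. Scrambling. A scrambled $(0,m,s)$-net in base $b$ is a random point set $\tilde P_n=\{\mathbf U_1,\dots,\mathbf U_n\}$ obtained from a $(0,m,s)$-net $\{\mathbf V_1,\dots,\mathbf V_n\}$ in base $b$ such that each $\mathbf U_l$ is uniformly distributed on $[0,1)^s$ and, for all $l\neq j$ and $\mathbf i\in\mathbb N^s$, if $(\mathbf V_l,\mathbf V_j)\in D_{\mathbf i}^s$ then $(\mathbf U_l,\mathbf U_j)$ is uniformly distributed in $D_{\mathbf i}^s$. Covariance. $\mathbf U_I,\mathbf U_J$ are two distinct randomly selected points of $\tilde P_n$: $(I,J)$ is a uniformly random ordered pair of distinct indices, independent of the scrambling. With $\psi$ the density of $(\mathbf U_I,\mathbf U_J)$ on $[0,1)^{2s}$ (the joint pdf), $$\mathrm{Cov}(f(\mathbf U_I),f(\mathbf U_J))=\int_{[0,1)^s}\int_{[0,1)^s}(\psi(\mathbf x,\mathbf y)-1)f(\mathbf x)\overline{f(\mathbf y)}\,d\mathbf x\,d\mathbf y.$$ Walsh functions. For $l\in\mathbb N$ with $l=\lambda_0+\lambda_1b+\lambda_2b^2+\cdots$ and $x\in[0,1)$ with $x=\xi_1b^{-1}+\xi_2b^{-2}+\cdots$ (finite expansion if possible), $\mathrm{wal}_l(x)=\omega_b^{\lambda_0\xi_1+\lambda_1\xi_2+\cdots}$ with $\omega_b=e^{2\pi i/b}$; $\mathrm{wal}_{\mathbf l}(\mathbf x)=\prod_{j=1}^s\mathrm{wal}_{l_j}(x_j)$.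 $\hat f(\mathbf l)=\int_{[0,1)^s}f(\mathbf x)\overline{\mathrm{wal}_{\mathbf l}(\mathbf x)}\,d\mathbf x$. For $\mathbf k\in\mathbb N^s$, $L_{\mathbf k}=\{\mathbf l\in\mathbb N^s:\lfloor b^{k_j-1}\rfloor\le l_j<b^{k_j},\ j=1,\dots,s\}$ and $\sigma_{\mathbf k}^2(f)=\sum_{\mathbf l\in L_{\mathbf k}}|\hat f(\mathbf l)|^2$. Walsh coefficients of the joint pdf. $\hat\psi(\mathbf l)$, $\mathbf l\ne\mathbf 0$, are the coefficients in the expansion $\psi(\mathbf x,\mathbf y)=1+\sum_{\mathbf l\ne\mathbf 0}\hat\psi(\mathbf l)\mathrm{wal}_{\mathbf l}(\mathbf x)\overline{\mathrm{wal}_{\mathbf l}(\mathbf y)}$, i.e. $\hat\psi(\mathbf l)=-(n-1)^{-1}(1-b)^{1-r}\sum_{i=0}^{r-1-c}(-b)^i\binom{r-1}{i}$, where for $\mathbf l\in L_{\mathbf k}$, $r$ is the number of non-zero coordinates of $\mathbf k$ and $c=\max(k_1+\cdots+k_s-m,0)$ (empty sums are $0$). $\hat\psi_{\mathbf k}$ denotes the common value of $\hat\psi(\mathbf l)$ for $\mathbf l\in L_{\mathbf k}$. *)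

(* Defs.v *)
From HB Require Import structures.
From mathcomp Require Import all_boot all_order all_algebra finmap.
From mathcomp Require Import complex.
From mathcomp Require Import all_classical all_reals all_analysis.
From mathcomp Require Export summability.

Set Implicit Arguments.
Unset Strict Implicit.
Unset Printing Implicit Defensive.

Import Order.TTheory GRing.Theory Num.Theory.
Import numFieldNormedType.Exports.

Local Open Scope classical_set_scope.
Local Open Scope ring_scope.
Local Open Scope complex_scope.

(** Lebesgue measure on [R^s], with [R^s] represented by [s.-tuple R]. *)

Section cons_measure.
Context {R : realType} (n : nat).
Variable mu : {sigma_finite_measure set (n.-tuple R) -> \bar R}.

(* [lebesgue_measure] is a measure on [measurableTypeR R], whose display differs
   from the one of the canonical measurable structure of [R]. *)
Local Notation RR := (measurableTypeR R).

Definition cons_pair (p : RR * n.-tuple R) : n.+1.-tuple R :=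
  [tuple of (p.1 : R) :: p.2].

Lemma measurable_cons_pair : measurable_fun [set: RR * n.-tuple R] cons_pair.
Proof.
have m1 : measurable_fun [set: RR * n.-tuple R]
    (fun p : RR * n.-tuple R => p.1 : R).
  by move=> mD Y mY; exact: (@measurable_fst _ _ RR (n.-tuple R)).
exact: (@measurable_cons _ _ _ _ _ n snd m1 measurable_snd).
Qed.

Definition cons_measure : set (n.+1.-tuple R) -> \bar R :=
  pushforward (lebesgue_measure \x mu)%E cons_pair.

Let cons_measure0 : cons_measure set0 = 0%E.
Proof. by rewrite /cons_measure /pushforward preimage_set0 measure0. Qed.

Let cons_measure_ge0 A : (0 <= cons_measure A)%E.
Proof. by rewrite /cons_measure /pushforward measure_ge0. Qed.

Let cons_measure_sigma_additive : semi_sigma_additive cons_measure.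
Proof.
move=> F mF tF mUF; rewrite /cons_measure /pushforward preimage_bigcup.
apply: measure_semi_sigma_additive.
- by move=> i; rewrite -[X in measurable X]setTI; exact: measurable_cons_pair.
- apply/trivIsetP => /= i j _ _ ij; rewrite -preimage_setI.
  by move/trivIsetP : tF => /(_ _ _ _ _ ij) ->//; rewrite preimage_set0.
- rewrite -preimage_bigcup -[X in measurable X]setTI.
  exact: measurable_cons_pair.
Qed.

HB.instance Definition _ := isMeasure.Build _ _ _ cons_measure
  cons_measure0 cons_measure_ge0 cons_measure_sigma_additive.

Definition uncons_pair (t : n.+1.-tuple R) : RR * n.-tuple R :=
  (thead t : R, [tuple of behead t]).

Lemma cons_pairK : cancel cons_pair uncons_pair.
Proof.
move=> [x t]; rewrite /uncons_pair /cons_pair /=; congr pair.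
by apply: val_inj.
Qed.

Lemma measurable_uncons_pair :
  measurable_fun [set: n.+1.-tuple R] uncons_pair.
Proof.
apply/measurable_fun_pairP; split.
  by move=> mD Y mY; exact: (@measurable_tnth _ R n.+1 ord0).
exact: measurable_behead.
Qed.

Let cons_measure_sigma_finite : sigma_finite setT cons_measure.
Proof.
(* the sigma-finite instance of product measures is not inferred here *)
have [F FT Fm] : sigma_finite setT (lebesgue_measure \x mu)%E.
  have /sigma_finiteP[F [TF ndF Foo]] := sigma_finiteT (@lebesgue_measure R).
  have /sigma_finiteP[G [TG ndG Goo]] := sigma_finiteT mu.
  exists (fun i => F i `*` G i).
    rewrite -setXTT TF TG predeqE => -[x y]; split.
      move=> [/= [i _ Fix] [k _ Gky]]; exists (maxn i k) => //; split.
      - by move: x Fix; exact/subsetPset/ndF/leq_maxl.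
      - by move: y Gky; exact/subsetPset/ndG/leq_maxr.
    by move=> [i _ []/= ? ?]; split; exists i.
  move=> k; have [? ?] := Foo k; have [? ?] := Goo k.
  split; first exact: measurableX.
  by rewrite product_measure1E// lte_mul_pinfty// ge0_fin_numE.
exists (fun i => uncons_pair @^-1` F i).
  by rewrite -preimage_bigcup -FT preimage_setT.
move=> i; have [mF Foo] := Fm i; split.
  by rewrite -[X in measurable X]setTI; exact: measurable_uncons_pair.
rewrite /cons_measure /pushforward -comp_preimage.
suff -> : uncons_pair \o cons_pair = id by [].
by apply/funext => p /=; rewrite cons_pairK.
Qed.

HB.instance Definition _ := Measure_isSigmaFinite.Build _ _ _ cons_measure
  cons_measure_sigma_finite.

End cons_measure.

Fixpoint tuple_lebesgue {R : realType} (s : nat) :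
    {sigma_finite_measure set (s.-tuple R) -> \bar R} :=
  match s with
  | 0 => \d_([tuple] : 0.-tuple R)
  | s'.+1 => cons_measure (tuple_lebesgue s')
  end.

(** The half-open unit cube [[0,1)^s]. *)
Definition cube {R : realType} (s : nat) : set (s.-tuple R) :=
  [set x | forall j, 0 <= tnth x j < 1].
Arguments cube {R} s.

Definition Cintegral d (T : measurableType d) (R : realType)
    (mu : {measure set T -> \bar R}) (D : set T) (f : T -> R[i]) : R[i] :=
  (\int[mu]_(x in D) complex.Re (f x))
    +i* (\int[mu]_(x in D) complex.Im (f x)).

Definition L2cube {R : realType} (s : nat) (f : s.-tuple R -> R[i]) : Prop :=
  [/\ measurable_fun (cube s) (fun x => complex.Re (f x)),
      measurable_fun (cube s) (fun x => complex.Im (f x)) &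
      (\int[tuple_lebesgue s]_(x in cube s)
         (complex.Re (f x) ^+ 2 + complex.Im (f x) ^+ 2)%:E < +oo)%E].

(** [X] is uniformly distributed on [D], with respect to [mu]. *)
Definition uniform_on d d' (Omega : measurableType d) (T : measurableType d')
    (R : realType) (P : probability Omega R) (mu : {measure set T -> \bar R})
    (X : Omega -> T) (D : set T) : Prop :=
  forall A : set T, measurable A ->
    P (X @^-1` A) = (fine (mu (A `&` D)) / fine (mu D))%:E.

Definition Cexpectation d (Omega : measurableType d) (R : realType)
    (P : probability Omega R) (X : Omega -> R[i]) : R[i] :=
  Cintegral P setT X.

Definition Ccovariance d (Omega : measurableType d) (R : realType)
    (P : probability Omega R) (X Y : Omega -> R[i]) : R[i] :=
  Cexpectation P (fun w => X w * (Y w)^*)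
    - Cexpectation P X * (Cexpectation P Y)^*.

(** Nets. *)

Definition sumk (s : nat) (k : s.-tuple nat) : nat :=
  (\sum_(j < s) tnth k j)%N.

Definition elementary_interval {R : realType} (b s : nat) (k a : s.-tuple nat)
    (x : s.-tuple R) : bool :=
  [forall j : 'I_s,
    ((tnth a j)%:R / b%:R ^+ tnth k j <= tnth x j)
      && (tnth x j < (tnth a j).+1%:R / b%:R ^+ tnth k j)].

Definition equidistributed {R : realType} (b m s : nat) (k : s.-tuple nat)
    (V : 'I_(b ^ m) -> s.-tuple R) : Prop :=
  forall a : s.-tuple nat, (forall j, tnth a j < b ^ tnth k j)%N ->
    #|[pred l | elementary_interval b k a (V l)]|%:R
      = b%:R ^ (m%:Z - (sumk k)%:Z) :> R.

Definition is_net {R : realType} (b m s : nat)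
    (V : 'I_(b ^ m) -> s.-tuple R) : Prop :=
  (forall l, cube s (V l)) /\
  (forall k : s.-tuple nat, (sumk k <= m)%N -> equidistributed k V).

(** [common_digits b x y i] states that [gamma_b(x, y) = i]; it holds for no
    [i] when [x = y]. *)
Definition common_digits {R : realType} (b : nat) (x y : R) (i : nat) : Prop :=
  Num.floor (b%:R ^+ i * x) = Num.floor (b%:R ^+ i * y) /\
  Num.floor (b%:R ^+ i.+1 * x) <> Num.floor (b%:R ^+ i.+1 * y).

Definition Dset {R : realType} (b s : nat) (i : s.-tuple nat) :
    set (s.-tuple R * s.-tuple R) :=
  [set p | [/\ cube s p.1, cube s p.2 &
    forall j, common_digits b (tnth p.1 j) (tnth p.2 j) (tnth i j)]].

Definition scrambled_net d (Omega : measurableType d) (R : realType)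
    (P : probability Omega R) (b m s : nat)
    (U : 'I_(b ^ m) -> {RV P >-> s.-tuple R}) : Prop :=
  (forall l w, cube s (U l w)) /\
  exists V : 'I_(b ^ m) -> s.-tuple R,
    [/\ is_net V,
        forall l, uniform_on P (tuple_lebesgue s) (U l) (cube s) &
        forall (l j : 'I_(b ^ m)) (i : s.-tuple nat), l != j ->
          Dset b i (V l, V j) ->
          uniform_on P (tuple_lebesgue s \x tuple_lebesgue s)%E
            (fun w => (U l w, U j w)) (Dset b i)].

(** [(I, J)] is a uniformly random ordered pair of distinct indices,
    independent of [(U_l)_l]. *)
Definition random_distinct_pair d d' (Omega : measurableType d)
    (T : measurableType d') (R : realType) (P : probability Omega R) (n : nat)
    (U : 'I_n -> Omega -> T) (I J : Omega -> 'I_n) : Prop :=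
  [/\ forall i, measurable (I @^-1` [set i]),
      forall j, measurable (J @^-1` [set j]) &
      forall (i j : 'I_n) (A : set (n.-tuple T)), i != j -> measurable A ->
        P ([set w | I w = i /\ J w = j]
             `&` [set w | A [tuple U l w | l < n]])
        = ((n * n.-1)%:R^-1%:E * P [set w | A [tuple U l w | l < n]])%E].

(** Walsh functions. *)

Definition omega {R : realType} (b : nat) : R[i] :=
  cos (2 * pi / b%:R) +i* sin (2 * pi / b%:R).

(* [digit b x i] is xi_i in the expansion x = xi_1 b^-1 + xi_2 b^-2 + ... *)
Definition digit {R : realType} (b : nat) (x : R) (i : nat) : nat :=
  (`|Num.floor (b%:R ^+ i * x)|%N %% b)%N.

(* For b >= 2 we have l < b ^ l, so that the digits lambda_i of l vanish for
   i >= l. *)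
Definition wal1 {R : realType} (b l : nat) (x : R) : R[i] :=
  omega b ^+ (\sum_(i < l) ((l %/ b ^ i) %% b) * digit b x i.+1)%N.

Definition wal {R : realType} (b s : nat) (l : s.-tuple nat)
    (x : s.-tuple R) : R[i] :=
  \prod_(j < s) wal1 b (tnth l j) (tnth x j).

Definition walsh_coef {R : realType} (b s : nat) (f : s.-tuple R -> R[i])
    (l : s.-tuple nat) : R[i] :=
  Cintegral (tuple_lebesgue s) (cube s) (fun x => f x * (wal b l x)^*).

Definition zero_index (s : nat) : s.-tuple nat := [tuple 0%N | _ < s].

(* (b ^ k) %/ b is the integer part of b ^ (k - 1), including for k = 0. *)
Definition Lset (b s : nat) (k : s.-tuple nat) : set (s.-tuple nat) :=
  [set l | forall j, (b ^ tnth k j %/ b <= tnth l j < b ^ tnth k j)%N].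

Definition sigma2 {R : realType} (b s : nat) (f : s.-tuple R -> R[i])
    (k : s.-tuple nat) : R[i] :=
  \sum_(l \in Lset b k) `|walsh_coef b f l| ^+ 2.

(** Walsh coefficients of the joint density psi of [(U_I, U_J)], i.e. of
      psi(x, y) = 1 + sum_(l <> 0) psi_hat(l) wal_l(x) (wal_l(y))^*,
    in closed form. *)

(* The sum over i = 0, ..., r - 1 - c has r - c terms; the truncated
   subtractions implement c = max(|k| - m, 0) and the empty sum for c >= r. *)
Definition psi_hatk {R : realType} (b m s : nat) (k : s.-tuple nat) : R :=
  let r := #|[pred j : 'I_s | tnth k j != 0%N]| in
  let c := (sumk k - m)%N in
  - ((b ^ m)%:R - 1)^-1 * (1 - b%:R) ^ (1 - r%:Z)
    * \sum_(i < r - c) (- b%:R) ^+ i * 'C(r.-1, i)%:R.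

(* The unique k with l in L_k: k_j is the number of base b digits of l_j. *)
Definition Lindex (b s : nat) (l : s.-tuple nat) : s.-tuple nat :=
  [tuple up_log b (tnth l j).+1 | j < s].

Lemma LsetP (b s : nat) (k l : s.-tuple nat) : (1 < b)%N ->
  Lset b k l <-> k = Lindex b l.
Proof.
move=> b1; split=> [kl|-> j].
  apply: eq_from_tnth => j; rewrite tnth_mktuple; have := kl j.
  case: (tnth k j) => [|e] /andP[le lt].
    by move: lt; rewrite expn0 ltnS leqn0 => /eqP ->; rewrite up_log1.
  apply/esym/up_log_eq => //; rewrite lt andbT ltnS.
  by move: le; rewrite expnS mulKn// (ltn_trans _ b1).
rewrite tnth_mktuple (up_logP _ b1) andbT.
have [->|l0] := posnP (tnth l j); first by rewrite up_log1 expn0 divn_small.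
have := up_log_gtn b1 (l0 : (1 < (tnth l j).+1)%N); rewrite ltnS.
have : (0 < up_log b (tnth l j).+1)%N by rewrite up_log_gt0 b1.
case: up_log => // e _ /=.
by rewrite expnS mulKn// (ltn_trans _ b1).
Qed.

Definition psi_hat {R : realType} (b m s : nat) (l : s.-tuple nat) : R :=
  psi_hatk b m (Lindex b l).

(** The sum of [g] over [D] is [v]: the net of partial sums over finite sets,
    ordered by inclusion, converges to [v] (unconditional convergence). *)
Definition has_sum (I : choiceType) (K : numFieldType) (D : set I)
    (g : I -> K) (v : K) : Prop :=
  partial_sum (fun i => if i \in D then g i else 0 : K^o) @ totally --> (v : K^o).

(* Main.v *)
(** The numbers psi_hat(l) vanish unless every l_j < b^m, so both series are
    finite sums and no completeness of the Walsh system is needed. Cut the cube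
    into the b^(ms) cells on which the first m digits of every coordinate are
    fixed. Distinct points of the net differ in the first m digits of every
    coordinate, so the law of (U_I, U_J) has a density that is constant on
    products of two cells. In dimension one, the normalised indicator of
    [gamma(x, y) = i], i < m, equals the sum over l < b^m of
    phi_i(k) wal_l(x) wal_l(y)^*, where k is the number of digits of l and
    phi_i(k) = (b [k <= i] - [k <= i + 1]) / (b - 1). Multiplying over the
    coordinates and averaging over the pairs of the net expands the density;
    its coefficient at l in L_k is the average of prod_j phi(k_j), and
    |L_k| prod_j phi(k_j) is a product of differences of the kernels
    b^k [gamma >= k], whose sums over all pairs are the counts of points in
    elementary intervals prescribed by the net property. *)

Require Import Defs.
From HB Require Import structures.
From mathcomp Require Import all_boot all_order all_algebra finmap.
From mathcomp Require Import complex.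
From mathcomp Require Import all_classical all_reals all_analysis.
From mathcomp Require Import measurable_realfun.
From mathcomp Require Import zify ring lra.

Set Implicit Arguments.
Unset Strict Implicit.
Unset Printing Implicit Defensive.

Import Order.TTheory GRing.Theory Num.Theory.
Import numFieldNormedType.Exports.

Local Open Scope ring_scope.

(** Because the density is constant on products of cells, [f] enters only through its integrals over
    the cells, and the covariance becomes a quadratic form on a finite set. The Walsh functions with
    all l_j < b^m diagonalise it; the term at l = 0 has coefficient 1 and equals the squared modulus
    of the mean, so subtracting the means removes exactly that term. The harder point is the closed
    form of the coefficients. Expanding the product of kernel differences is an inclusion-exclusion
    over the r nonzero coordinates of k, and the net counts turn it into an alternating sum of
    powers b^max(|k| - m - t, 0) with weights C(r, t). The closed form of psi_hat is instead a
    truncated binomial sum in powers of -b; an induction on c = max(|k| - m, 0) relates the two.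
    Moreover the counts run over all ordered pairs, including equal points, while the density
    averages over distinct ones: the diagonal has to be split off, and it produces the summand -1 /
    (n - 1), which is the whole coefficient when |k| <= m. *)

(** A number [x] in [0, 1) is represented by [v = floor (b ^ m * x) < b ^ m], i.e. by
    its first [m] digits; [agree b m k] compares the first [k] of them. *)
Definition agree (b m k v v' : nat) : bool :=
  (v %/ b ^ (m - k) == v' %/ b ^ (m - k))%N.

(** [gamma_b] of two distinct representatives; the junk value is [m] when [v = v']. *)
Definition ncommon (b m v v' : nat) : nat :=
  find (fun k => ~~ agree b m k.+1 v v') (iota 0 m).

(** * Digit prefixes and their agreement *)

Section Digits.
Variables (b m : nat).
Hypothesis b1 : (1 < b)%N.
Local Open Scope nat_scope.

Lemma agree_sym k v v' : agree b m k v v' = agree b m k v' v.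
Proof. by rewrite /agree eq_sym. Qed.

Lemma agreexx k v : agree b m k v v.
Proof. exact: eqxx. Qed.

Lemma agree_pred k v v' : k < m -> agree b m k.+1 v v' -> agree b m k v v'.
Proof.
move=> km /eqP e; rewrite /agree.
have -> : m - k = (m - k.+1).+1 by lia.
by rewrite expnSr !divnMA e.
Qed.

Lemma agree_le k k' v v' : k <= k' -> k' <= m -> agree b m k' v v' -> agree b m k v v'.
Proof.
elim: k' => [|k' IH]; first by rewrite leqn0 => /eqP ->.
rewrite leq_eqVlt => /orP[/eqP ->//|]; rewrite ltnS => kk' km c.
by apply: IH => //; [exact: ltnW | exact: agree_pred].
Qed.

Lemma agree0 v v' : v < b ^ m -> v' < b ^ m -> agree b m 0 v v'.
Proof. by move=> vm v'm; rewrite /agree subn0 !divn_small. Qed.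

Lemma agreem v v' : agree b m m v v' = (v == v').
Proof. by rewrite /agree subnn expn0 !divn1. Qed.

Lemma ncommon_ltn v v' : v < b ^ m -> v' < b ^ m -> v != v' -> ncommon b m v v' < m.
Proof.
move=> vm v'm ne; rewrite /ncommon -[X in _ < X](size_iota 0 m) -has_find.
have m0 : 0 < m.
  case: posnP ne => // m0; move: vm v'm; rewrite m0 expn0 !ltnS !leqn0.
  by move=> /eqP -> /eqP ->.
apply/hasP; exists m.-1; first by rewrite mem_iota /= add0n ltn_predL.
by rewrite prednK// agreem.
Qed.

Lemma agree_ncommon v v' k : v < b ^ m -> v' < b ^ m -> v != v' -> k <= m ->
  agree b m k v v' = (k <= ncommon b m v v').
Proof.
move=> vm v'm ne km; have gm := ncommon_ltn vm v'm ne.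
have cg : agree b m (ncommon b m v v') v v'.
  case e : (ncommon b m v v') => [|g]; first exact: agree0.
  have gg : g < ncommon b m v v' by rewrite e.
  have := before_find 0 gg; rewrite nth_iota ?add0n; last exact: ltn_trans gm.
  by move/negbFE.
have ncg : ~~ agree b m (ncommon b m v v').+1 v v'.
  have h : has (fun k => ~~ agree b m k.+1 v v') (iota 0 m).
    by rewrite has_find size_iota.
  by have := nth_find 0 h; rewrite -/(ncommon b m v v') nth_iota ?add0n.
case: leqP => [kg|gk]; first by apply: agree_le cg => //; exact: ltnW.
by apply/negbTE; apply: contra ncg; exact: agree_le.
Qed.

Lemma sum_divn_eq d N c : 0 < d -> c < N ->
  \sum_(q < N * d) (q %/ d == c) = d.
Proof.
move=> d0 cN; rewrite -(big_mkord xpredT (fun q => (q %/ d == c) : nat)).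
rewrite (@big_cat_nat _ _ _ (c * d)) //=; last by rewrite leq_mul2r (ltnW cN) orbT.
rewrite (@big_cat_nat _ _ _ (c.+1 * d) (c * d)) //=.
- rewrite (_ : \sum_(0 <= i < c * d) _ = 0) ?add0n; last first.
    rewrite big_nat big1// => i /andP[_]; rewrite -ltn_divLR// => h.
    by rewrite ltn_eqF.
  rewrite (_ : \sum_(c.+1 * d <= i < N * d) _ = 0) ?addn0; last first.
    rewrite big_nat big1// => i /andP[]; rewrite -leq_divRL// => h _.
    by rewrite gtn_eqF.
  rewrite (_ : \sum_(c * d <= i < c.+1 * d) _ = \sum_(c * d <= i < c.+1 * d) 1).
    by rewrite sum_nat_const_nat muln1 mulSn addnK.
  rewrite big_nat [RHS]big_nat; apply: eq_bigr => i /andP[h1 h2].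
  by rewrite eqn_leq -ltnS ltn_divLR// leq_divRL// h1 h2.
- by rewrite leq_mul2r leqnSn orbT.
- by rewrite leq_mul2r cN orbT.
Qed.

Lemma sum_agree k p : k <= m -> p < b ^ m ->
  \sum_(q < b ^ m) agree b m k p q = b ^ (m - k).
Proof.
move=> km pm; have e : b ^ m = b ^ k * b ^ (m - k) by rewrite -expnD subnKC.
under eq_bigr do rewrite agree_sym.
rewrite /agree -(big_mkord xpredT (fun q => (q %/ _ == _) : nat)) {1}e big_mkord.
apply: sum_divn_eq; first by rewrite expn_gt0; lia.
by rewrite ltn_divLR ?expn_gt0 -?e; lia.
Qed.

End Digits.

(** * Sums over base b expansions and the one-dimensional kernel *)

Lemma big_ord_mul (R : Type) (idx : R) (op : Monoid.law idx) (N b : nat)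
    (F : nat -> R) :
  \big[op/idx]_(l < N * b) F l =
  \big[op/idx]_(l' < N) \big[op/idx]_(r < b) F (l' * b + r)%N.
Proof.
elim: N => [|N IH]; first by rewrite mul0n !big_ord0.
rewrite mulSn addnC big_split_ord /= IH big_ord_recr /=.
by congr (op _ _); apply: eq_bigr => i _.
Qed.

(** The digits of [l] range independently, so the sum factors; the induction splits off the lowest
    digit, [l = l' * b + r]. *)
Lemma sum_prod_digits (K : comPzRingType) (b k : nat) (x : nat -> K) :
  (0 < b)%N ->
  \sum_(l < b ^ k) \prod_(i < k) x i ^+ ((l %/ b ^ i) %% b) =
  \prod_(i < k) \sum_(r < b) x i ^+ r.
Proof.
move=> b0; elim: k x => [|k IH] x.
  by rewrite expn0 big_ord_recl big_ord0 !big_ord0 addr0.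
rewrite expnSr.
rewrite (big_ord_mul _ (b ^ k) b (fun l => \prod_(i < k.+1) x i ^+ ((l %/ b ^ i) %% b))).
rewrite big_ord_recl -(IH (fun i => x i.+1)) mulr_sumr.
apply: eq_bigr => l' _; rewrite mulr_suml; apply: eq_bigr => r _.
rewrite big_ord_recl expn0 divn1 modnMDl modn_small//; congr (_ * _).
apply: eq_bigr => i _; rewrite /= /bump /= add1n expnS divnMA.
by rewrite divnMDl// (divn_small (ltn_ord r)) addn0.
Qed.

Lemma up_log_succ_le (b l i : nat) : (1 < b)%N ->
  (up_log b l.+1 <= i)%N = (l < b ^ i)%N.
Proof.
move=> b1; apply/idP/idP => [h|h]; last exact: (up_log_min b1 h).
exact: leq_trans (up_logP l.+1 b1) (leq_pexp2l (ltnW b1) h).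
Qed.

(** With K_k = b^k [gamma >= k], the sum of wal_l(x) wal_l(y)^* over l < b^k, the normalised
    indicator of gamma = i is (b K_i - K_(i+1)) / (b - 1). Reading off the coefficient of an l with
    k digits gives this formula: 1 for k <= i, -1 / (b - 1) for k = i + 1, and 0 beyond. *)
Definition phi {F : numFieldType} (b i k : nat) : F :=
  (b%:R * (k <= i)%N%:R - (k <= i.+1)%N%:R) / (b%:R - 1).

(** The set [gamma = i] in [0,1)^2 has measure [(b - 1) / b ^ i.+1]. *)
Definition density1 {F : numFieldType} (b m i p q : nat) : F :=
  b%:R ^+ i.+1 / (b%:R - 1) * (agree b m i p q && ~~ agree b m i.+1 p q)%:R.

Lemma sum_nat_cut (V : nmodType) (N n : nat) (G : nat -> V) : (n <= N)%N ->
  \sum_(l < N) (if (l < n)%N then G l else 0) = \sum_(l < n) G l.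
Proof.
by move=> nN; rewrite [RHS](big_ord_widen _ G nN) [RHS]big_mkcond.
Qed.

Section Kernel.
Variables (F : numFieldType) (b m : nat).
Hypothesis b1 : (1 < b)%N.

Lemma b_neq0 : b%:R != 0 :> F. Proof. by rewrite pnatr_eq0; lia. Qed.

Lemma bB1_neq0 : b%:R - 1 != 0 :> F.
Proof. by rewrite subr_eq0 pnatr_eq1; lia. Qed.

Lemma phi_k0 i : phi b i 0 = 1 :> F.
Proof. by rewrite /phi !leq0n mulr1 divff ?bB1_neq0. Qed.

(** A bound on the number of digits of [l] is a cutoff [l < b ^ i], so the Walsh products [z l]
    enter only through their sums over initial segments. *)
Lemma sum_phi (z : nat -> F) i p q : (i < m)%N ->
  (forall k, (k <= m)%N -> \sum_(l < b ^ k) z l = b%:R ^+ k * (agree b m k p q)%:R) ->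
  \sum_(l < b ^ m) phi b i (up_log b l.+1) * z l = density1 b m i p q.
Proof.
move=> im orth.
have -> : \sum_(l < b ^ m) phi b i (up_log b l.+1) * z l =
   (b%:R * (\sum_(l < b ^ m) (if (l < b ^ i)%N then z l else 0))
     - \sum_(l < b ^ m) (if (l < b ^ i.+1)%N then z l else 0)) / (b%:R - 1).
  rewrite mulr_sumr -sumrB mulr_suml; apply: eq_bigr => l _.
  rewrite /phi !up_log_succ_le// mulrAC; congr (_ / _).
  by rewrite mulrBl -mulrA; case: ifP; case: ifP; rewrite ?mul1r ?mul0r.
rewrite !sum_nat_cut ?leq_exp2l //; last exact: ltnW.
rewrite !orth//; last exact: ltnW.
rewrite /density1 exprS; case e : (agree b m i.+1 p q) => /=.
  by rewrite (agree_pred b1 im e) /= mulrA; field; exact: bB1_neq0.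
by case: (agree b m i p q) => /=; field; exact: bB1_neq0.
Qed.

(** The number b^(m-i) - b^(m-i-1) of admissible [q] cancels the normalising factor. This is the
    source of the uniform marginals: averaged over one variable, the density is 1. *)
Lemma sum_density1 i p : (i < m)%N -> (p < b ^ m)%N ->
  \sum_(q < b ^ m) density1 b m i p q = b%:R ^+ m :> F.
Proof.
move=> im pm; rewrite /density1 -mulr_sumr.
have -> : \sum_(q < b ^ m) (agree b m i p q && ~~ agree b m i.+1 p q)%:R =
   (b ^ (m - i))%:R - (b ^ (m - i.+1))%:R :> F.
  rewrite -(sum_agree b1 (ltnW im) pm) -(sum_agree b1 im pm) !natr_sum -sumrB.
  apply: eq_bigr => q _; case e : (agree b m i.+1 p q).
    by rewrite (agree_pred b1 im e) subrr.
  by rewrite andbT subr0.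
have -> : (m - i = (m - i.+1).+1)%N by lia.
rewrite -[in RHS](subnKC im) exprD expnS !natrM !natrX.
by field; exact: bB1_neq0.
Qed.

End Kernel.

(** * Binomial identities behind the closed form *)

(** Pascal's rule makes the alternating sum telescope. *)
Lemma alt_binom_partial (K : pzRingType) (r c : nat) :
  \sum_(t < c.+1) (-1) ^+ t *+ 'C(r.+1, t) = (-1) ^+ c *+ 'C(r, c) :> K.
Proof.
elim: c => [|c IH]; first by rewrite big_ord1 !bin0.
by rewrite big_ord_recr /= IH binS mulrnDr exprS mulN1r mulNrn addrCA mulNrn subrr addr0.
Qed.

(** With [x = b] and [r.+1] nonzero coordinates, the left side comes from summing
    over the pairs of the net, the right side from the closed form of psi_hat. *)
Lemma psi_sum_identity (F : comPzRingType) (x : F) (r c : nat) :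
  x ^+ r.+1 * (\sum_(t < c) (-1) ^+ t * 'C(r.+1, t)%:R * (x ^+ (c - t) - 1)) =
  x ^+ c * (x - 1) * (-1) ^+ r *
   ((1 - x) ^+ r - \sum_(i < r.+1 - c) (- x) ^+ i * 'C(r, i)%:R).
Proof.
elim: c => [|c IH].
  rewrite big_ord0 mulr0 subn0.
  have -> : (1 - x) ^+ r = \sum_(i < r.+1) (- x) ^+ i * 'C(r, i)%:R.
    rewrite exprDn; apply: eq_bigr => i _.
    by rewrite expr1n mul1r mulr_natr.
  by rewrite subrr mulr0.
(* Split x^(c+1-t) - 1 = x (x^(c-t) - 1) + (x - 1); the remainders x - 1, including the one at t =
   c, add up to a partial alternating sum. *)
have -> : \sum_(t < c.+1) (-1) ^+ t * 'C(r.+1, t)%:R * (x ^+ (c.+1 - t) - 1) =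
   x * (\sum_(t < c) (-1) ^+ t * 'C(r.+1, t)%:R * (x ^+ (c - t) - 1))
   + (x - 1) * ((-1) ^+ c *+ 'C(r, c)).
  rewrite -alt_binom_partial !big_ord_recr /= [(x - 1) * (_ + _)]mulrDr addrA subSnn expr1.
  congr (_ + _); last by rewrite mulr_natr mulrC.
  rewrite !mulr_sumr -big_split; apply: eq_bigr => t _ /=.
  rewrite -mulr_natr subSn ?(ltnW (ltn_ord t))// exprS; ring.
rewrite mulrDr mulrCA IH.
(* For c > r both truncated sums are empty and C(r, c) = 0. For c <= r, passing to c + 1 drops the
   term of index r - c, which C(r, r - c) = C(r, c) matches with the new summand. *)
have [cr|rc] := leqP c r; last first.
  have -> : (r.+1 - c = 0)%N by lia.
  have -> : (r.+1 - c.+1 = 0)%N by lia.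
  rewrite bin_small// mulr0n mulr0 mulr0 addr0 !big_ord0 exprS; ring.
have -> : (r.+1 - c = (r.+1 - c.+1).+1)%N by lia.
rewrite big_ord_recr /= subSS bin_sub//.
set S := \sum_(i < _) _.
have -> : x ^+ r.+1 = x ^+ c.+1 * x ^+ (r - c) by rewrite -exprD; congr (_ ^+ _); lia.
have -> : (-1) ^+ c = (-1) ^+ r * (-1) ^+ (r - c) :> F.
  rewrite -exprD -signr_odd -[RHS]signr_odd; congr (_ ^+ _).
  by rewrite oddD oddB// addbA addbb.
have -> : (- x) ^+ (r - c) = (-1) ^+ (r - c) * x ^+ (r - c) by exact: exprNn.
rewrite -mulr_natr [x ^+ c.+1]exprS.
ring.
Qed.

Lemma sum_subsets_card (V : nmodType) (T : finType) (S : {set T}) (H : nat -> V) :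
  \sum_(A : {set T} | A \subset S) H #|A| = \sum_(t < #|S|.+1) H t *+ 'C(#|S|, t).
Proof.
rewrite (partition_big (fun A : {set T} => inord #|A| : 'I_#|S|.+1) xpredT)//=.
apply: eq_bigr => t _; rewrite -cards_draws -[X in _ *+ X]sum1_card -sumrMnr.
rewrite [RHS](eq_bigl (fun A : {set T} => (A \subset S) && (inord #|A| == t))).
  by apply: eq_bigr => A /andP[AS /eqP <-]; rewrite mulr1n inordK// ltnS subset_leq_card.
move=> A; rewrite inE; case AS : (A \subset S) => //=.
by rewrite -val_eqE /= inordK// ltnS subset_leq_card.
Qed.

(** * Counting pairs of net points *)

Section Net.
Variables (b m s : nat).
Hypothesis b1 : (1 < b)%N.
Variable v : 'I_(b ^ m) -> 'I_s -> nat.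
Hypothesis vlt : forall l j, (v l j < b ^ m)%N.
Hypothesis vnet : forall k : 'I_s -> nat, (\sum_j k j <= m)%N -> forall l0,
  #|[pred l | [forall j, agree b m (k j) (v l0 j) (v l j)]]| = (b ^ (m - \sum_j k j))%N.

(** The truncated exponent covers [\sum_j k j > m], where the count is 1. *)
Lemma box_count (k : 'I_s -> nat) (l0 : 'I_(b ^ m)) : (forall j, k j <= m)%N ->
  #|[pred l | [forall j, agree b m (k j) (v l0 j) (v l j)]]| = (b ^ (m - \sum_j k j))%N.
Proof.
have [c] := ubnP (\sum_j k j - m)%N.
elim: c k => // c IH k; rewrite ltnS => kc km.
have [|mk] := leqP (\sum_j k j)%N m; first by move=> h; exact: vnet.
have /existsP[j0 j0P] : [exists j, 0 < k j]%N.
  rewrite -[X in is_true X]negbK negb_exists; apply/negP => /forallP k0.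
  by move: mk; rewrite big1// => j _; apply/eqP; rewrite -leqn0 leqNgt; exact: k0.
(* Lowering one positive exponent enlarges the box and keeps the exponent sum at least m. By
   induction the larger box holds just one point, and [l0] lies in the smaller one. *)
pose k' j := (k j - (j == j0))%N.
have sk : (\sum_j k j = (\sum_j k' j).+1)%N.
  rewrite (bigD1 j0)//= [in RHS](bigD1 j0)//= /k' eqxx.
  rewrite (eq_bigr (fun j => k j - (j == j0))%N) => [|j /negPf ->]; last by rewrite subn0.
  by move: j0P; lia.
have k'm j : (k' j <= m)%N by rewrite (leq_trans (leq_subr _ _)).
have := IH k' _ k'm; rewrite (_ : m - \sum_j k' j = 0)%N; last by lia.
rewrite (_ : m - \sum_j k j = 0)%N; last by lia.
rewrite expn0 => h; apply/eqP; rewrite eqn_leq; apply/andP; split.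
  rewrite -h; last by lia.
  apply/subset_leq_card/fintype.subsetP => l; rewrite !inE => /forallP H.
  apply/forallP => j; apply: (agree_le b1 _ _ (H j)) => //; exact: leq_subr.
by apply/card_gt0P; exists l0; rewrite inE; apply/forallP => j; exact: agreexx.
Qed.

(** Fixing all m digits of the single coordinate [j] uses up the exponent sum m, and such a box
    holds one point. *)
Lemma net_distinct l0 l j : l0 != l -> v l0 j != v l j.
Proof.
move=> ne; apply/negP => /eqP e; pose k i := (if i == j then m else 0)%N.
have ks : (\sum_i k i = m)%N by rewrite -big_mkcond big_pred1_eq.
have := @vnet k _ l0; rewrite ks subnn expn0 => /(_ (leqnn _)) h.
have : (#|pred2 l0 l| <= 1)%N.
  rewrite -h; apply/subset_leq_card/fintype.subsetP => i; rewrite !inE => /orP[]/eqP ->.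
    by apply/forallP => i'; exact: agreexx.
  apply/forallP => i'; rewrite /k; case: eqP => [->|_]; first by rewrite agreem e.
  exact: agree0.
by rewrite card2 ne.
Qed.

Variable F : numFieldType.

(** The coefficient of [wal_l(x) (wal_l(y))^*], l in L_k, in the density of [(U_I, U_J)]. *)
Definition net_coef (k : 'I_s -> nat) : F :=
  ((b ^ m)%:R * ((b ^ m)%:R - 1))^-1 *
  \sum_l0 \sum_(l | l0 != l) \prod_j phi b (ncommon b m (v l0 j) (v l j)) (k j).

(** For fixed [l0] the product is b^|k| times the indicator that [l] lies in the box of [l0], so
    [box_count] evaluates the inner sum independently of [l0]. *)
Lemma pair_sum (k : 'I_s -> nat) : (forall j, k j <= m)%N ->
  \sum_l0 \sum_l \prod_j (b%:R ^+ k j * (agree b m (k j) (v l0 j) (v l j))%:R)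
   = b%:R ^+ m * b%:R ^+ (\sum_j k j) * b%:R ^+ (m - \sum_j k j)%N :> F.
Proof.
move=> km; rewrite -[X in _ = X * _ * _]natrX -mulrA mulr_natl.
rewrite -[in RHS](card_ord (b ^ m)) -sumr_const; apply: eq_bigr => l0 _.
rewrite -[X in _ = _ * X]natrX -(box_count l0 km) -sum1_card natr_sum mulr_sumr.
rewrite [RHS]big_mkcond; apply: eq_bigr => l _; rewrite big_split /= mulr1.
rewrite expr_sum -natr_prod.
set p := (X in _ * X%:R = _).
have -> : p = ([forall j, agree b m (k j) (v l0 j) (v l j)] : nat).
  rewrite {}/p; case: forallP => [H|H]; first by rewrite big1// => j _; rewrite H.
  have /existsP[j /negPf jP] : [exists j, ~~ agree b m (k j) (v l0 j) (v l j)].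
    by rewrite -negb_forall; apply/forallP.
  by rewrite (bigD1 j)//= jP.
by rewrite unfold_in; case: ifP => _; rewrite ?mulr1 ?mulr0.
Qed.

(** The number of [l] with exactly [k] digits in base [b]. *)
Definition card_L1 (k : nat) : F := if k is k'.+1 then b%:R ^+ k' * (b%:R - 1) else 1.

(** The sum of [wal_l(x) (wal_l(y))^*] over the [l] with exactly [k] digits. *)
Definition kernel_diff (k : nat) (x y : nat) : F :=
  (if k == 0%N then 0 else - (b%:R ^+ k.-1 * (agree b m k.-1 x y)%:R))
  + b%:R ^+ k * (agree b m k x y)%:R.

Lemma card_L1_neq0 k : card_L1 k != 0.
Proof.
case: k => [|k]; rewrite ?oner_neq0// mulf_neq0 ?expf_neq0 ?b_neq0//.
exact: bB1_neq0.
Qed.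

(** For k >= 1 the factor b - 1 of [card_L1] clears the denominator of [phi]. Comparisons with gamma
    thereby become agreements, which the net property counts. Distinctness matters, [ncommon] being
    a junk value on the diagonal. *)
Lemma card_L1_phi k x y : (k <= m)%N -> (x < b ^ m)%N -> (y < b ^ m)%N -> x != y ->
  card_L1 k * phi b (ncommon b m x y) k = kernel_diff k x y.
Proof.
move=> km xm ym xy; rewrite /kernel_diff; case: k km => [|k] km /=.
  by rewrite phi_k0// agree0// add0r expr0 !mul1r.
rewrite !agree_ncommon//; last exact: ltnW.
rewrite /phi ltnS exprS; field; exact: bB1_neq0.
Qed.

Lemma kernel_diff_diag k x : kernel_diff k x x = card_L1 k.
Proof.
rewrite /kernel_diff !agreexx !mulr1; case: k => [|k] /=; first by rewrite add0r.
rewrite exprS; ring.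
Qed.

(** This is |L_k| = b^(|k| - r) (b - 1)^r, with b^r moved to the left to keep the exponents
    natural. *)
Lemma prod_card_L1 (k : 'I_s -> nat) :
  \prod_j card_L1 (k j) * b%:R ^+ #|[pred j | k j != 0]%N| =
  b%:R ^+ (\sum_j k j) * (b%:R - 1) ^+ #|[pred j | k j != 0]%N| :> F.
Proof.
rewrite -sum1_card expr_sum [X in _ * X = _]big_mkcond /=.
rewrite [in RHS]expr_sum [X in _ = _ * X]expr_sum [X in _ = _ * X]big_mkcond /=.
rewrite -!big_split; apply: eq_bigr => j _ /=.
rewrite inE; case: (k j) => [|k'] /=; rewrite ?mulr1 ?expr0 ?expr1// exprS; ring.
Qed.

(** Inclusion-exclusion: [A] collects the coordinates in which the subtracted kernel of order k_j -
    1 is chosen. Each choice is a [pair_sum] for lowered exponents, and its value depends on [A]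
    through the size only. *)
Lemma sum_kernel_diff (k : 'I_s -> nat) : (forall j, k j <= m)%N ->
  \sum_l0 \sum_l \prod_j kernel_diff (k j) (v l0 j) (v l j) =
  b%:R ^+ m * b%:R ^+ m * \sum_(t < #|[pred j | k j != 0]%N|.+1)
    (-1) ^+ t * 'C(#|[pred j | k j != 0]%N|, t)%:R * b%:R ^+ (\sum_j k j - m - t)%N :> F.
Proof.
move=> km; pose S := [set j | k j != 0%N].
have cS : #|[pred j | k j != 0%N]| = #|S| by rewrite cardsE.
rewrite cS mulr_sumr.
pose H t : F := b%:R ^+ m * b%:R ^+ m * ((-1) ^+ t * b%:R ^+ (\sum_j k j - m - t)%N).
rewrite [RHS](eq_bigr (fun t : 'I_#|S|.+1 => H t *+ 'C(#|S|, t))); last first.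
  by move=> t _; rewrite /H -[RHS]mulr_natr; ring.
rewrite -sum_subsets_card [RHS]big_mkcond /=.
under eq_bigr do under eq_bigr do rewrite bigA_distr.
under eq_bigr do rewrite exchange_big.
rewrite exchange_big /=; apply: eq_bigr => A _.
(* A coordinate with k_j = 0 has no subtracted kernel, so a set [A] containing one contributes 0. *)
case: ifPn => AS; last first.
  rewrite big1// => l0 _; rewrite big1// => l _.
  have /fintype.subsetPn[j jA] := AS; rewrite inE negbK => kj.
  by rewrite (bigD1 j)//= jA kj mul0r.
pose k' j := (k j - (j \in A))%N.
have k'm j : (k' j <= m)%N by rewrite (leq_trans (leq_subr _ _)).
have sk : (\sum_j k' j + #|A| = \sum_j k j)%N.
  rewrite -sum1_card [X in (_ + X)%N]big_mkcond -big_split.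
  apply: eq_bigr => j _ /=; rewrite /k'; case: ifP => jA; last by rewrite subn0 addn0.
  by have := fintype.subsetP AS _ jA; rewrite inE; case: (k j) => // ? _; lia.
transitivity ((-1) ^+ #|A| * \sum_l0 \sum_l
    \prod_j (b%:R ^+ k' j * (agree b m (k' j) (v l0 j) (v l j))%:R) : F).
  rewrite mulr_sumr; apply: eq_bigr => l0 _; rewrite mulr_sumr; apply: eq_bigr => l _.
  rewrite -sum1_card expr_sum [X in _ = X * _]big_mkcond -big_split; apply: eq_bigr => j _ /=.
  rewrite /k'; case: ifP => jA; last by rewrite subn0 mul1r.
  have := fintype.subsetP AS _ jA; rewrite inE => /negPf ->.
  by rewrite expr1 mulN1r subn1.
rewrite pair_sum// /H -sk.
(* Both sides equal max(|k'|, m), the subtractions being truncated. *)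
have : (\sum_j k' j + (m - \sum_j k' j) = m + (\sum_j k' j + #|A| - m - #|A|))%N.
  by lia.
move: (\sum_j k' j)%N (m - _)%N (_ - _ - _)%N => x y z xyz.
have e : b%:R ^+ x * b%:R ^+ y = b%:R ^+ m * b%:R ^+ z :> F by rewrite -!exprD xyz.
by rewrite -[b%:R ^+ m * _ * _]mulrA e; ring.
Qed.

Lemma net_coef0 (k : 'I_s -> nat) : (0 < m)%N -> (forall j, k j = 0)%N -> net_coef k = 1.
Proof.
move=> m0 k0; rewrite /net_coef.
under eq_bigr do under eq_bigr do (rewrite big1; last by [move=> j _; rewrite k0 phi_k0]).
under eq_bigr => l0 do rewrite sumr_const.
have b2 : (2 <= b ^ m)%N by rewrite (leq_trans b1)// -[X in (X <= _)%N]expn1 leq_pexp2l// ltnW.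
rewrite (eq_bigr (fun => (b ^ m)%:R - 1)); last first.
  move=> l0 _; rewrite (@eq_card _ _ (predC1 l0)) => [|l]; last by rewrite !inE eq_sym.
  by rewrite cardC1 card_ord -subn1 natrB// ltnW.
rewrite sumr_const card_ord -[X in _ * X = _]mulr_natl mulVf// mulf_neq0//.
  by rewrite pnatr_eq0; lia.
by rewrite subr_eq0 pnatr_eq1; lia.
Qed.

(** Multiplying by |L_k| and adding the diagonal gives the sum over all pairs, so 1 + (n - 1)
    [net_coef k] is that sum divided by n |L_k|; [psi_sum_identity] puts it into closed form. *)
Lemma net_coefE (k : 'I_s -> nat) : (0 < m)%N -> (forall j, k j <= m)%N ->
  (exists j, k j != 0)%N ->
  let r := #|[pred j | k j != 0]%N| in
  let c := (\sum_j k j - m)%N in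
  net_coef k = - ((b ^ m)%:R - 1)^-1 * (1 - b%:R) ^ (1 - r%:Z)
    * \sum_(i < r - c) (- b%:R) ^+ i * 'C(r.-1, i)%:R :> F.
Proof.
move=> m0 km [j0 kj0] r c.
have b2 : (2 <= b ^ m)%N by rewrite (leq_trans b1)// -[X in (X <= _)%N]expn1 leq_pexp2l// ltnW.
pose L := \prod_j card_L1 (k j).
have L0 : L != 0 by apply/prodf_neq0 => j _; exact: card_L1_neq0.
have n0 : (b ^ m)%:R != 0 :> F by rewrite pnatr_eq0; lia.
have n1 : (b ^ m)%:R - 1 != 0 :> F by rewrite subr_eq0 pnatr_eq1; lia.
have := sum_kernel_diff km; rewrite -/r -/c.
rewrite (eq_bigr (fun l0 : 'I_(b ^ m) => L + L * \sum_(l | l0 != l)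
   \prod_j phi b (ncommon b m (v l0 j) (v l j)) (k j))); last first.
  move=> l0 _; rewrite (bigD1 l0)//=; congr (_ + _).
    by apply: eq_bigr => j _; rewrite kernel_diff_diag.
  rewrite mulr_sumr [LHS](eq_bigl (fun l => l0 != l)) => [|l]; last by rewrite eq_sym.
  apply: eq_bigr => l ne; rewrite -big_split; apply: eq_bigr => j _ /=.
  by rewrite card_L1_phi// net_distinct.
rewrite big_split /= sumr_const card_ord -mulr_sumr.
have -> : \sum_l0 \sum_(l | l0 != l) \prod_j phi b (ncommon b m (v l0 j) (v l j)) (k j)
   = (b ^ m)%:R * ((b ^ m)%:R - 1) * net_coef k.
  by rewrite /net_coef mulrA divff ?mul1r// mulf_neq0.
have r0 : (0 < r)%N by apply/card_gt0P; exists j0.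
have rE : r = r.-1.+1 by rewrite prednK.
(* The full alternating sum of C(r, t) vanishes since r > 0. Subtracting it makes every term with t
   >= c zero, so the range can be changed to t < c. *)
have -> : \sum_(t < r.+1) (-1) ^+ t * 'C(r, t)%:R * b%:R ^+ (c - t) =
  \sum_(t < c) (-1) ^+ t * 'C(r, t)%:R * (b%:R ^+ (c - t) - 1) :> F.
  have e0 : \sum_(t < r.+1) (-1) ^+ t * 'C(r, t)%:R = 0 :> F.
    under eq_bigr do rewrite mulr_natr.
    by rewrite [in LHS]rE alt_binom_partial bin_small.
  rewrite -[LHS]subr0 -[X in _ - X = _]e0 -sumrB.
  pose G t : F := (-1) ^+ t * 'C(r, t)%:R * (b%:R ^+ (c - t) - 1).
  rewrite (eq_bigr (fun t : 'I_r.+1 => G t)); last by move=> t _; rewrite /G mulrBr mulr1.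
  rewrite -[RHS]/(\sum_(t < c) G t).
  have Gc t : (c <= t)%N -> G t = 0.
    by rewrite /G -subn_eq0 => /eqP ->; rewrite expr0 subrr mulr0.
  have Gr t : (r < t)%N -> G t = 0 by move=> rt; rewrite /G bin_small// mulr0 mul0r.
  have [h|h] := leqP c r.+1.
    rewrite -[RHS](sum_nat_cut _ h); apply: eq_bigr => t _.
    by case: ltnP => // /Gc.
  rewrite -[LHS](sum_nat_cut _ (ltnW h)); apply: eq_bigr => t _.
  by case: ltnP => // /Gr.
set A := \sum_(t < c) _; set C := net_coef k.
set S := \sum_(i < r - c) _ => E.
have I1 := psi_sum_identity (b%:R : F) r.-1 c; rewrite -rE -/A -/S in I1.
have PL := prod_card_L1 k; rewrite -/L -/r in PL.
have key : L * b%:R ^+ m * (1 + ((b ^ m)%:R - 1) * C) = b%:R ^+ m * b%:R ^+ m * A.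
  by rewrite -E -(mulr_natr L) natrX; ring.
have bm0 : b%:R ^+ m != 0 :> F by rewrite -natrX.
have bn0 := b_neq0 F b1; have b10 := bB1_neq0 F b1.
have {}key : L * (1 + ((b ^ m)%:R - 1) * C) = b%:R ^+ m * A.
  by apply: (mulfI bm0); rewrite [LHS]mulrA [b%:R ^+ m * L]mulrC key mulrA.
have b1N : 1 - b%:R != 0 :> F by rewrite -opprB oppr_eq0.
have pw : (1 - b%:R) ^ (1 - r%:Z) = (1 - b%:R) ^- r.-1 :> F.
  rewrite [in LHS]rE (_ : 1 - r.-1.+1%:Z = - r.-1%:Z); last by lia.
  by rewrite -exprnN.
rewrite pw.
suff h : 1 + ((b ^ m)%:R - 1) * C = 1 - (1 - b%:R) ^- r.-1 * S.
  by apply: (mulfI n1); move/addrI: h => ->; field; rewrite expf_neq0 ?n1.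
have main : A * b%:R ^+ r * b%:R ^+ m =
  b%:R ^+ (\sum_j k j) * (b%:R - 1) ^+ r * (1 - (1 - b%:R) ^- r.-1 * S).
  have -> : (b%:R - 1) ^+ r = (b%:R - 1) * (-1) ^+ r.-1 * (1 - b%:R) ^+ r.-1 :> F.
    by rewrite {1}rE exprS -mulrA -exprMn; congr (_ * _ ^+ _); ring.
  have [mk|km'] := leqP m (\sum_j k j)%N.
    rewrite -(subnK mk) -/c exprD mulrC [A * _]mulrC I1.
    by field; rewrite expf_neq0.
  (* For |k| < m the identity at c = 0 forces S = (1 - b)^(r-1), and both sides vanish: the
     coefficient is -1 / (n - 1). *)
  have c0 : c = 0%N by rewrite /c; lia.
  have -> : A = 0 by rewrite /A c0 big_ord0.
  have -> : S = (1 - b%:R) ^+ r.-1.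
    apply/esym/eqP; rewrite -subr_eq0; move: I1.
    rewrite /A c0 big_ord0 mulr0 expr0 mul1r => /esym/eqP.
    by rewrite !mulf_eq0 signr_eq0 (negPf b10) !orFb.
  by rewrite mulVf ?expf_neq0// subrr mulr0 !mul0r.
apply: (mulfI L0); rewrite key.
have br0 : b%:R ^+ r != 0 :> F by rewrite expf_neq0.
by apply: (mulIf br0); rewrite [RHS]mulrAC PL -main; ring.
Qed.

End Net.

Local Open Scope classical_set_scope.
Local Open Scope ring_scope.
Local Open Scope complex_scope.

(** * Walsh functions on cells *)

Section Walsh1.
Variable R : realType.
Implicit Types x y : R.

Definition nfloor x : nat := `|Num.floor x|%N.

Lemma nfloorP x n : 0 <= x -> (nfloor x = n) <-> (n%:R <= x < n.+1%:R).
Proof.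
move=> x0; split => [<-|/andP[nx xn]].
  have f0 : 0 <= Num.floor x by rewrite floor_ge0.
  have e : (nfloor x)%:R = (Num.floor x)%:~R :> R by rewrite natr_absz ger0_norm.
  by rewrite -natr1 e floor_le/= -[X in _ + X]/(1%:~R) -intrD floorD1_gt.
rewrite /nfloor (@floor_def _ x n%:Z) ?absz_nat//.
by rewrite intrD -!pmulrn natr1 nx.
Qed.

Lemma nfloor_mul x (d : nat) : 0 <= x -> (0 < d)%N ->
  (nfloor (d%:R * x) %/ d = nfloor x)%N.
Proof.
move=> x0 d0; have d0' : 0 < d%:R :> R by rewrite ltr0n.
have /andP[h1 h2] : (nfloor x)%:R <= x < (nfloor x).+1%:R by apply/nfloorP.
have dx0 : 0 <= d%:R * x by rewrite mulr_ge0// ltW.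
have /andP[h3 h4] : (nfloor (d%:R * x))%:R <= d%:R * x < (nfloor (d%:R * x)).+1%:R.
  by apply/nfloorP.
apply/eqP; rewrite eqn_leq; apply/andP; split.
  rewrite -ltnS ltn_divLR// -(ltr_nat R) natrM; apply: le_lt_trans h3 _.
  by rewrite mulrC ltr_pM2r.
rewrite leq_divRL// -ltnS -(ltr_nat R) natrM; apply: le_lt_trans h4.
by rewrite mulrC ler_pM2l.
Qed.

Definition cell1 (b m : nat) x := nfloor (b%:R ^+ m * x).

Variables (b m : nat).
Hypothesis pb : prime b.

Let b1 : (1 < b)%N. Proof. exact: prime_gt1. Qed.

Lemma cell1_lt x : 0 <= x < 1 -> (cell1 b m x < b ^ m)%N.
Proof.
move=> /andP[x0 x1]; have bm0 : 0 < b%:R ^+ m :> R by rewrite exprn_gt0// ltr0n; lia.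
have /andP[h _] : (cell1 b m x)%:R <= b%:R ^+ m * x < (cell1 b m x).+1%:R.
  by apply/nfloorP => //; rewrite mulr_ge0// ltW.
rewrite -(ltr_nat R) natrX; apply: le_lt_trans h _.
by rewrite -[ltRHS]mulr1 ltr_pM2l.
Qed.

Lemma cell1_div x i : 0 <= x -> (i <= m)%N ->
  (cell1 b m x %/ b ^ (m - i) = nfloor (b%:R ^+ i * x))%N.
Proof.
move=> x0 im; rewrite -(@nfloor_mul _ (b ^ (m - i))) ?expn_gt0 ?(ltnW b1)//.
  by rewrite /cell1 natrX mulrA -exprD subnK.
by rewrite mulr_ge0// exprn_ge0.
Qed.

Lemma digit_cell1 x i : 0 <= x -> (i <= m)%N ->
  digit b x i = (cell1 b m x %/ b ^ (m - i) %% b)%N.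
Proof. by move=> x0 im; rewrite cell1_div. Qed.

Local Notation w := (@omega R b).

Lemma omega_de_moivre n :
  w ^+ n = cos (2 * pi / b%:R *+ n) +i* sin (2 * pi / b%:R *+ n) :> R[i].
Proof.
rewrite /omega; move: (2 * pi / b%:R) => t.
elim: n => [|n IH]; first by rewrite expr0 mulr0n cos0 sin0.
rewrite exprS IH mulrS cosD sinD; apply/eqP; rewrite eq_complex /=.
by rewrite eqxx/= [X in _ == X]addrC eqxx.
Qed.

Lemma omega_expb : w ^+ b = 1.
Proof.
rewrite omega_de_moivre -mulr_natr divfK ?pnatr_eq0 -?lt0n ?(ltnW b1)//.
by rewrite mulr_natl cos2pi sin2pi.
Qed.

Lemma omega_neq1 : w != 1.
Proof.
apply/eqP => -[c1 s0]; have b2 := b1; have pi0 := pi_gt0 R.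
have b0 : 0 < b%:R :> R by rewrite ltr0n; lia.
(* For b = 2 the sine vanishes and the cosine, equal to -1, decides; for b >= 3 the angle lies
   strictly between 0 and pi. *)
have [b2'|b3] := leqP b 2.
  have e2 : b = 2%N by lia.
  move: c1; rewrite e2 (_ : 2 * pi / 2%:R = pi :> R); last by field.
  by rewrite cospi; lra.
suff : 0 < sin (2 * pi / b%:R) :> R by rewrite s0 ltxx.
apply: sin_gt0_pi; rewrite divr_gt0 ?mulr_gt0//= ltr_pdivrMr// mulrC ltr_pM2l//.
by rewrite ltr_nat.
Qed.

(** Primality enters here: the order of [w] divides b and is not 1. *)
Lemma omega_prim : b.-primitive_root w.
Proof.
have [k kw kb] := prim_order_exists (ltnW b1) omega_expb.
have /primeP[_ /(_ k kb)/orP[/eqP k1|/eqP e]] := pb; last by rewrite e in kw.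
by move: kw; rewrite k1 => /prim_expr_order; rewrite expr1 => /eqP; rewrite (negPf omega_neq1).
Qed.

Lemma omega_conj : w * w^* = 1.
Proof.
apply/eqP; rewrite eq_complex /=; apply/andP; split; apply/eqP; last by ring.
by rewrite mulrN opprK -!expr2 cos2Dsin2.
Qed.

Lemma geo_sum_neq1 (K : idomainType) (z : K) n : z != 1 -> z ^+ n = 1 ->
  \sum_(r < n) z ^+ r = 0.
Proof.
move=> z1 zn; apply/eqP; have := subrX1 z n; rewrite zn subrr => /esym/eqP.
by rewrite mulf_eq0 subr_eq0 (negPf z1).
Qed.

Lemma sum_char u v : (u < b)%N -> (v < b)%N ->
  \sum_(r < b) (w ^+ u * (w^* ) ^+ v) ^+ r = b%:R * (u == v)%:R :> R[i].
Proof.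
move=> ub vb; have wc n : w ^+ n * w^* ^+ n = 1 by rewrite -exprMn omega_conj expr1n.
case: eqVneq => [<-|uv].
  by rewrite wc mulr1 (eq_bigr (fun=> 1)) ?sumr_const ?card_ord// => r _; rewrite expr1n.
rewrite mulr0; apply: geo_sum_neq1.
  apply: contra uv => /eqP h; have : w ^+ u == w ^+ v.
    by rewrite -[w ^+ u]mulr1 -(wc v) [w ^+ v * _]mulrC mulrA h mul1r.
  by rewrite (eq_prim_root_expr omega_prim) !modn_small.
rewrite exprMn -!exprM ![(_ * b)%N]mulnC !exprM omega_expb expr1n mul1r.
by rewrite -rmorphXn /= omega_expb rmorph1 expr1n.
Qed.

Definition cell_digit (p i : nat) := (p %/ b ^ (m - i.+1) %% b)%N.

(** The first m digits are constant on a cell, and l < b^m involves no others. Writing the value as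
    one factor per digit is what lets sums over [l] factor. *)
Definition cell_wal (l p : nat) : R[i] :=
  \prod_(i < m) (w ^+ cell_digit p i) ^+ (l %/ b ^ i %% b).

Lemma wal1_cell1 l x : 0 <= x -> (l < b ^ m)%N -> wal1 b l x = cell_wal l (cell1 b m x).
Proof.
move=> x0 lm; rewrite /wal1 /cell_wal.
pose E i := (l %/ b ^ i %% b * digit b x i.+1)%N.
have E0 i : (l < b ^ i)%N -> E i = 0%N by move=> h; rewrite /E divn_small// mod0n.
(* [wal1] runs over i < l and [cell_wal] over i < m; since l < b^l and l < b^m, both ranges contain
   every nonzero digit of [l]. *)
have -> : (\sum_(i < l) E i = \sum_(i < m) E i)%N.
  have aux n n' : (n <= n')%N -> (l < b ^ n)%N -> (\sum_(i < n) E i = \sum_(i < n') E i)%N.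
    move=> nn' ln; rewrite (big_ord_widen _ E nn') big_mkcond; apply: eq_bigr => i _.
    by case: ltnP => // ni; rewrite E0// (leq_trans ln)// leq_pexp2l// ltnW.
  have [lm'|ml] := leqP l m; first by apply: aux => //; exact: ltn_expl.
  by apply/esym/aux => //; exact: ltnW.
rewrite expr_sum; apply: eq_bigr => i _.
by rewrite -exprM mulnC /E /cell_digit -digit_cell1.
Qed.

Lemma agree_cell_digit k p q : (k < m)%N ->
  agree b m k.+1 p q = agree b m k p q && (cell_digit p k == cell_digit q k).
Proof.
move=> km; rewrite /agree /cell_digit; have -> : (m - k = (m - k.+1).+1)%N by lia.
rewrite expnSr !divnMA.
move: (p %/ _)%N (q %/ _)%N => x y; apply/eqP/andP => [->|[/eqP h1 /eqP h2]] //.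
by rewrite (divn_eq x b) (divn_eq y b) h1 h2.
Qed.

Lemma prod_cell_digit k p q : (p < b ^ m)%N -> (q < b ^ m)%N -> (k <= m)%N ->
  \prod_(i < k) (cell_digit p i == cell_digit q i)%:R = (agree b m k p q)%:R :> R[i].
Proof.
move=> pm qm; elim: k => [_|k IH km]; first by rewrite big_ord0 agree0.
by rewrite big_ord_recr /= IH ?(ltnW km)// agree_cell_digit// -natrM mulnb.
Qed.

(** Each digit of [l] contributes a character sum, equal to b when the matching digits of the two
    cells coincide and 0 otherwise; only the first k digits take part. *)
Lemma sum_cell_wal k p q : (p < b ^ m)%N -> (q < b ^ m)%N -> (k <= m)%N ->
  \sum_(l < b ^ k) cell_wal l p * (cell_wal l q)^* = b%:R ^+ k * (agree b m k p q)%:R.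
Proof.
move=> pm qm km; pose z i := w ^+ cell_digit p i * (w^* ) ^+ cell_digit q i.
transitivity (\sum_(l < b ^ k) \prod_(i < k) z i ^+ (l %/ b ^ i %% b)).
  apply: eq_bigr => l _; rewrite /cell_wal rmorph_prod -big_split /=.
  rewrite (eq_bigr (fun i : 'I_m => z i ^+ (l %/ b ^ i %% b))); last first.
    by move=> i _; rewrite !rmorphXn exprMn.
  rewrite [RHS](big_ord_widen _ (fun i => z i ^+ (l %/ b ^ i %% b)) km) [RHS]big_mkcond.
  apply: eq_bigr => i _; case: ltnP => // ki.
  by rewrite divn_small ?mod0n ?expr0// (leq_trans (ltn_ord l))// leq_pexp2l// ltnW.
rewrite sum_prod_digits ?(ltnW b1)//.
rewrite (eq_bigr (fun i : 'I_k => b%:R * (cell_digit p i == cell_digit q i)%:R)); last first.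
  by move=> i _; rewrite sum_char// ltn_mod ltnW.
by rewrite big_split /= prod_cell_digit// prodr_const card_ord.
Qed.

End Walsh1.

(** * The density on pairs of cells and its Walsh expansion *)

Section Density.
Variables (R : realType) (b m s : nat).
Hypothesis pb : prime b.
Let b1 : (1 < b)%N. Proof. exact: prime_gt1. Qed.

Local Notation C := {ffun 'I_s -> 'I_(b ^ m)}.

(** The density of [(U_I, U_J)] on the product of the cells [p] and [q], for a net
    whose points lie in the cells [v l]. *)
Definition cell_density (v : 'I_(b ^ m) -> 'I_s -> nat) (p q : C) : R :=
  ((b ^ m)%:R * ((b ^ m)%:R - 1))^-1 *
  \sum_l0 \sum_(l | l0 != l) \prod_j density1 b m (ncommon b m (v l0 j) (v l j)) (p j) (q j).

(** No normalising factor appears because [F p] will be the integral of [f] over the cell, not a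
    value of [f]. *)
Definition cell_walsh_coef (F : C -> R[i]) (l : C) : R[i] :=
  \sum_(p : C) F p * (\prod_j cell_wal R b m (l j) (p j))^*.

Lemma phiC i k : (phi b i k : R)%:C = phi b i k :> R[i].
Proof. by rewrite /phi rmorphM fmorphV !rmorphB rmorphM !rmorph_nat rmorph1. Qed.

Lemma dens1C i p q : (density1 b m i p q : R)%:C = density1 b m i p q :> R[i].
Proof. by rewrite /density1 !rmorphM fmorphV rmorphB rmorphXn !rmorph_nat rmorph1. Qed.

Lemma density1_sym i p q : density1 b m i p q = density1 b m i q p :> R.
Proof. by rewrite /density1 !(agree_sym b m _ p). Qed.

(** By symmetry of the density the conjugate can sit on the first argument, where it meets [F p] in
    the quadratic form to build a Walsh coefficient. *)
Lemma density1_cell_wal i p q : (i < m)%N -> (p < b ^ m)%N -> (q < b ^ m)%N ->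
  (density1 b m i p q : R)%:C = \sum_(l < b ^ m) (phi b i (up_log b l.+1) : R)%:C *
     ((cell_wal R b m l p)^* * cell_wal R b m l q).
Proof.
move=> im pm qm; rewrite density1_sym dens1C.
rewrite -(@sum_phi _ _ _ b1 (fun l => cell_wal R b m l q * (cell_wal R b m l p)^* ))//.
  by apply: eq_bigr => l _; rewrite phiC [_^* * _]mulrC.
by move=> k km; rewrite sum_cell_wal.
Qed.

Variable v : 'I_(b ^ m) -> 'I_s -> nat.
Hypothesis vlt : forall l j, (v l j < b ^ m)%N.
Hypothesis vne : forall l0 l j, l0 != l -> v l0 j != v l j.

Lemma cell_density_cell_wal (p q : C) : (cell_density v p q)%:C =
  \sum_(l : C) (net_coef v R (fun j => up_log b (l j).+1))%:C *
   ((\prod_j cell_wal R b m (l j) (p j))^* * \prod_j cell_wal R b m (l j) (q j)).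
Proof.
rewrite /cell_density /net_coef rmorphM /=; under [RHS]eq_bigr do rewrite rmorphM /= -mulrA.
rewrite -mulr_sumr; congr (_ * _).
under [RHS]eq_bigr do rewrite rmorph_sum mulr_suml.
rewrite exchange_big /= rmorph_sum; apply: eq_bigr => l0 _.
under [RHS]eq_bigr do rewrite rmorph_sum mulr_suml.
rewrite exchange_big /= rmorph_sum; apply: eq_bigr => l ne.
rewrite rmorph_prod /=.
under eq_bigr => j _ do rewrite density1_cell_wal ?ncommon_ltn ?vne//.
rewrite bigA_distr_bigA /=; apply: eq_bigr => f _.
by rewrite rmorph_prod rmorph_prod -!big_split.
Qed.

(** The Walsh expansion separates [p] from [q]: each frequency contributes its coefficient times a
    sum over [p] and the conjugate of the same sum over [q]. *)
Lemma sum_cell_density (F : C -> R[i]) :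
  \sum_p \sum_q (cell_density v p q)%:C * (F p * (F q)^* ) =
  \sum_(l : C) (net_coef v R (fun j => up_log b (l j).+1))%:C * `|cell_walsh_coef F l| ^+ 2.
Proof.
under eq_bigr do under eq_bigr do rewrite cell_density_cell_wal mulr_suml.
under eq_bigr do rewrite exchange_big /=.
rewrite exchange_big; apply: eq_bigr => l _ /=.
rewrite sqr_normc /cell_walsh_coef rmorph_sum mulr_suml mulr_sumr.
apply: eq_bigr => p _; rewrite !mulr_sumr; apply: eq_bigr => q _.
by move: (net_coef _ _ _) => c; rewrite rmorphM /= conjcK; ring.
Qed.

(** Constant row sums express that the first marginal is uniform: multiplied by the cell volume
    b^(-ms) they give 1. *)
Lemma sum_cell_density_r (p : C) : (1 < b ^ m)%N -> \sum_q cell_density v p q = b%:R ^+ (m * s).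
Proof.
move=> n1; rewrite /cell_density -mulr_sumr exchange_big /=.
rewrite (eq_bigr (fun=> ((b ^ m)%:R - 1) * b%:R ^+ (m * s))); last first.
  move=> l0 _; rewrite exchange_big /= (eq_bigr (fun=> b%:R ^+ (m * s))).
    rewrite sumr_const (@eq_card _ _ (predC1 l0)) => [|l]; last by rewrite !inE eq_sym.
    by rewrite cardC1 card_ord -subn1 -[LHS]mulr_natl natrB// ltnW.
  move=> l ne; rewrite -(bigA_distr_bigA (fun j (q : 'I_(b ^ m)) =>
     density1 b m (ncommon b m (v l0 j) (v l j)) (p j) q)) /=.
  under eq_bigr => j _ do rewrite sum_density1 ?ncommon_ltn ?vne//.
  by rewrite prodr_const card_ord exprM.
rewrite sumr_const card_ord -[X in _ * X = _]mulr_natl [X in _ * X = _]mulrA mulrA mulVf ?mul1r//.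
by rewrite mulf_neq0 ?subr_eq0 ?pnatr_eq0 ?pnatr_eq1; lia.
Qed.

Lemma cell_density_sym (p q : C) : cell_density v p q = cell_density v q p.
Proof.
rewrite /cell_density; congr (_ * _); apply: eq_bigr => l0 _; apply: eq_bigr => l _.
by apply: eq_bigr => j _; rewrite density1_sym.
Qed.

End Density.

(** * Integration against mixtures of restricted measures, and products *)

Section MixtureOfRestrictions.
Context d (T : measurableType d) (R : realType).
Variable mu : {measure set T -> \bar R}.
Local Open Scope ereal_scope.

Lemma ge0_integral_mrestr (B : set T) (mB : measurable B) (f : T -> \bar R) :
  measurable_fun setT f -> (forall x, 0 <= f x) ->
  \int[mrestr mu mB]_x f x = \int[mu]_(x in B) f x.
Proof.
move=> mf f0.
rewrite (@ge0_negligible_integral _ _ _ (mrestr mu mB) setT (~` B))//=.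
- rewrite setDE setCK setTI; apply: eq_measure_integral => A mA AB.
  by rewrite /= /mrestr setIidl.
- exact: measurableC.
- by rewrite /mrestr setICl measure0.
Qed.

Variables (I : finType) (i0 : I) (w : I -> R) (B : I -> set T).
Hypothesis w0 : forall i, (0 <= w i)%R.
Hypothesis mB : forall i, measurable (B i).
Variable nu : {measure set T -> \bar R}.
Hypothesis nuE : forall A, measurable A -> nu A = \sum_i (w i)%:E * mu (A `&` B i).

Lemma ge0_integral_mixture (f : T -> \bar R) :
  measurable_fun setT f -> (forall x, 0 <= f x) ->
  \int[nu]_x f x = \sum_i (w i)%:E * \int[mu]_(x in B i) f x.
Proof.
(* [msum] adds measures indexed by natural numbers, so [I] is enumerated, with [i0] as the default
   of [nth]. *)
move=> mf f0; pose e k := nth i0 (enum I) k.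
pose m k : {measure set T -> \bar R} := mscale (NngNum (w0 (e k))) (mrestr mu (mB (e k))).
have sumE (G : I -> \bar R) : \sum_(k < #|I|) G (e k) = \sum_i G i.
  rewrite [RHS]big_enum_val /= ; apply: eq_bigr => k _; congr G.
  by rewrite (enum_val_nth i0) //= enumT.
rewrite (@eq_measure_integral _ _ _ _ (msum m #|I|)); last first.
  move=> A mA _; rewrite nuE// -sumE.
  by apply: eq_bigr => k _.
rewrite ge0_integral_measure_sum// -sumE; apply: eq_bigr => k _.
by rewrite ge0_integral_mscale// ge0_integral_mrestr.
Qed.

Lemma integral_mixture (f : T -> R) : measurable_fun setT f ->
  (forall i, mu.-integrable (B i) (EFin \o f)) ->
  nu.-integrable setT (EFin \o f) /\
  (\int[nu]_x f x = \sum_i w i * \int[mu]_(x in B i) f x)%R.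
Proof.
move=> mf fi; have mf' : measurable_fun setT (EFin \o f) by exact/measurable_EFinP.
have fin i : \int[mu]_(x in B i) (EFin \o f) x \is a fin_num by exact: integrable_fin_num.
have finp i : \int[mu]_(x in B i) (EFin \o f)^\+ x \is a fin_num.
  by apply: integrable_fin_num => //; exact: integrable_funepos.
have finn i : \int[mu]_(x in B i) (EFin \o f)^\- x \is a fin_num.
  by apply: integrable_fin_num => //; exact: integrable_funeneg.
have int : nu.-integrable setT (EFin \o f).
  apply/integrableP; split => //; rewrite ge0_integral_mixture//; last first.
    exact: measurableT_comp.
  by apply: lte_sum_pinfty => i _; apply: lte_mul_pinfty; rewrite ?lee_fin//;
    have /integrableP[] := fi i.
split => //; rewrite /Rintegral integralE.
rewrite !ge0_integral_mixture//; [|exact: measurable_funeneg|exact: measurable_funepos].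
rewrite -[RHS]/(fine (_%:E)) -sumEFin; congr fine.
rewrite (eq_bigr (fun i => (w i * fine (\int[mu]_(x in B i) (EFin \o f)^\+ x))%:E)); last first.
  by move=> i _; rewrite EFinM fineK.
rewrite [X in _ - X](eq_bigr (fun i =>
  (w i * fine (\int[mu]_(x in B i) (EFin \o f)^\- x))%:E)); last first.
  by move=> i _; rewrite EFinM fineK.
rewrite !sumEFin -EFinB -sumrB; congr (_%:E); apply: eq_bigr => i _.
by rewrite -mulrBr; congr (_ * _)%R; rewrite [in RHS]integralE [RHS]fineB.
Qed.

End MixtureOfRestrictions.

Section ProductIntegral.
Context d1 d2 (T1 : measurableType d1) (T2 : measurableType d2) (R : realType).
Variables (m1 : {sigma_finite_measure set T1 -> \bar R})
          (m2 : {sigma_finite_measure set T2 -> \bar R}).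

Lemma integral_prod_mul (A : set T1) (B : set T2) (u : T1 -> R) (v : T2 -> R) :
  measurable A -> measurable B ->
  m1.-integrable A (EFin \o u) -> m2.-integrable B (EFin \o v) ->
  (m1 \x m2)%E.-integrable (A `*` B) (EFin \o (fun z => u z.1 * v z.2)) /\
  \int[(m1 \x m2)%E]_(z in A `*` B) (u z.1 * v z.2) =
    (\int[m1]_(x in A) u x) * (\int[m2]_(y in B) v y).
Proof.
move=> mA mB iu iv.
(* Extension by zero replaces A x B by the whole product space while keeping the product form. *)
pose u' := u \_ A; pose v' := v \_ B.
have iu' : m1.-integrable setT (EFin \o u').
  by rewrite /u' -restrict_EFin; apply/(integrable_mkcond _ mA).
have iv' : m2.-integrable setT (EFin \o v').
  by rewrite /v' -restrict_EFin; apply/(integrable_mkcond _ mB).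
pose g (z : T1 * T2) := u' z.1 * v' z.2.
have gE : (fun z : T1 * T2 => u z.1 * v z.2) \_ (A `*` B) = g.
  apply/funext => -[x y]; rewrite /g /u' /v' /patch /= in_setX /=.
  by case: (x \in A); case: (y \in B); rewrite ?mul0r ?mulr0.
have mu' : measurable_fun setT u' by apply/measurable_EFinP; exact: measurable_int iu'.
have mv' : measurable_fun setT v' by apply/measurable_EFinP; exact: measurable_int iv'.
have mg : measurable_fun setT (EFin \o g).
  apply/measurable_EFinP; apply: measurable_funM.
    exact: measurableT_comp mu' measurable_fst.
  exact: measurableT_comp mv' measurable_snd.
have mAB : measurable (A `*` B) by exact: measurableX.
have ig : (m1 \x m2)%E.-integrable setT (EFin \o g).
  apply/integrable12ltyP => //.
  have E x : (\int[m2]_y `|(EFin \o g) (x, y)| = `|u' x|%:E * \int[m2]_y `|(EFin \o v') y|)%E.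
    transitivity (\int[m2]_y (`|u' x|%:E * (`|v' y|)%:E))%E.
      by apply: eq_integral => y _; rewrite /= /g normrM EFinM.
    rewrite ge0_integralZl//=.
    by apply/measurable_EFinP; exact: measurableT_comp mv'.
  under eq_integral => x _ do rewrite E.
  have /integrableP[_ hv] := iv'; have /integrableP[_ hu] := iu'.
  rewrite ge0_integralZr//=.
  - by rewrite lte_mul_pinfty ?integral_ge0 ?ge0_fin_numE ?integral_ge0.
  - by apply/measurable_EFinP; exact: measurableT_comp mu'.
  - by apply: integral_ge0.
split; first by apply/integrable_mkcond => //; rewrite restrict_EFin gE.
rewrite Rintegral_mkcond gE /Rintegral.
rewrite -[in LHS](integral12_prod_meas1 ig) /= /fubini_F.
have fv := integrable_fin_num measurableT iv'.
have E x : (\int[m2]_y (EFin \o g) (x, y) = (u' x)%:E * (fine (\int[m2]_y (v' y)%:E))%:E)%E.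
  transitivity (\int[m2]_y ((u' x)%:E * (v' y)%:E))%E.
    by apply: eq_integral => y _; rewrite /= /g EFinM.
  by rewrite integralZl//= (fineK fv).
under eq_integral => x _ do rewrite E.
rewrite integralZr//= fineM//; last exact: integrable_fin_num.
by rewrite -/(Rintegral _ _ _) -/(Rintegral _ _ _) -!Rintegral_mkcond.
Qed.

End ProductIntegral.

(** * Cells of the unit cube *)

Lemma fsbig_fin (V : nmodType) (I : finType) (Q : pred I) (G : I -> V) :
  \sum_(i \in [set i | Q i]) G i = \sum_(i | Q i) G i.
Proof.
rewrite (@fsbigE _ _ _ _ _ [seq i <- index_enum I | Q i]).
- rewrite big_filter_cond; apply: eq_bigl => i.
  by apply/andP/idP => [[]//|Qi]; split => //; rewrite inE.
- by rewrite filter_uniq// index_enum_uniq.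
- by move=> i /=; rewrite mem_filter => /andP[].
- by move=> i /= Qi; rewrite mem_filter Qi mem_index_enum.
Qed.

Lemma measure_setI_bigcup d (T : measurableType d) (R : realType)
    (mu : {measure set T -> \bar R}) (I : finType) (Q : pred I)
    (B : I -> set T) (A : set T) :
  (forall i, measurable (B i)) -> trivIset setT B -> measurable A ->
  mu (A `&` \bigcup_(i in [set i | Q i]) B i) = \sum_(i | Q i) mu (A `&` B i) :> \bar R.
Proof.
move=> mB tB mA; rewrite setI_bigcupr measure_fin_bigcup ?fsbig_fin//.
- exact: finite_finset.
- by move=> i j _ _ [x [[_ xi] [_ xj]]]; apply: tB => //; exists x.
- by move=> i _; exact: measurableI.
Qed.

Section Boxes.
Variable R : realType.

Definition tbox s (A : 'I_s -> set R) : set (s.-tuple R) :=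
  [set x | forall j, A j (tnth x j)].

Lemma measurable_tbox s (A : 'I_s -> set R) : (forall j, measurable (A j)) ->
  measurable (tbox A).
Proof.
move=> mA; have -> : tbox A = \bigcap_(j in [set: 'I_s]) ((@tnth s R)^~ j @^-1` (A j)).
  by apply/seteqP; split => x h => [j _|j]; exact: h.
apply: fin_bigcap_measurable => // j _; rewrite -[X in measurable X]setTI.
exact: measurable_tnth.
Qed.

Lemma tuple_lebesgue_tbox s (A : 'I_s -> set R) (r : 'I_s -> R) :
  (forall j, measurable (A j)) ->
  (forall j, lebesgue_measure (A j : set (measurableTypeR R)) = (r j)%:E) ->
  tuple_lebesgue s (tbox A) = (\prod_j r j)%:E.
Proof.
elim: s A r => [|s IH] A r mA rA.
  rewrite big_ord0 /= diracE mem_set// => -[]//.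
rewrite big_ord_recl EFinM -rA -(IH (fun j => A (lift ord0 j)))//.
rewrite /= /cons_measure /pushforward.
have -> : @cons_pair R s @^-1` tbox A = A ord0 `*` tbox (fun j => A (lift ord0 j)).
  apply/seteqP; split => -[x y] /=.
    move=> h; split => [|j]; first exact: (h ord0).
    by have := h (lift ord0 j); rewrite /= /cons_pair tnthS.
  move=> [h0 h] j; have [j' ->|->] := unliftP ord0 j; last exact: h0.
  by rewrite /cons_pair tnthS; exact: h.
rewrite product_measure1E//; first exact: (mA ord0).
by apply: measurable_tbox => j; exact: mA.
Qed.

Lemma cube_tbox s : @cube R s = tbox (fun=> `[0, 1[%classic).
Proof.
by apply/seteqP; split => x h j; have := h j; rewrite /= in_itv.
Qed.

Lemma measurable_unit_cube s : measurable (@cube R s).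
Proof. by rewrite cube_tbox; apply: measurable_tbox => j; exact: measurable_itv. Qed.

Lemma tuple_lebesgue_cube s : tuple_lebesgue s (@cube R s) = 1%E.
Proof.
rewrite cube_tbox (@tuple_lebesgue_tbox _ _ (fun=> 1)).
- by rewrite big1.
- by move=> j; exact: measurable_itv.
- by move=> j; rewrite lebesgue_measure_itv /= lte_fin ltr01 -EFinD subr0.
Qed.

Variables (b m : nat).
Hypothesis pb : prime b.
Let b1 : (1 < b)%N. Proof. exact: prime_gt1. Qed.
Let bm0 : 0 < b%:R ^+ m :> R. Proof. by rewrite exprn_gt0// ltr0n ltnW. Qed.

Definition cell_itv (a : nat) : set R :=
  `[a%:R / b%:R ^+ m, a.+1%:R / b%:R ^+ m[%classic.

Lemma cell_itvP a x : (a < b ^ m)%N ->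
  cell_itv a x <-> (0 <= x < 1) /\ cell1 b m x = a.
Proof.
move=> am; rewrite /cell_itv /= in_itv /= ler_pdivrMr// ltr_pdivlMr//.
rewrite [x * _]mulrC; split=> [/andP[h1 h2]|[/andP[x0 x1] e]].
  have x0 : 0 <= x by rewrite -(pmulr_rge0 x bm0) (le_trans _ h1).
  split; last by apply/nfloorP; rewrite ?h1 ?h2// mulr_ge0// ltW.
  rewrite x0 -(ltr_pM2l bm0) mulr1; apply: lt_le_trans h2 _.
  by rewrite -natrX ler_nat.
by apply/nfloorP => //; rewrite mulr_ge0// ltW.
Qed.

Lemma lebesgue_cell_itv a :
  lebesgue_measure (cell_itv a : set (measurableTypeR R)) = ((b%:R ^+ m)^-1)%:E.
Proof.
rewrite /cell_itv lebesgue_measure_itv /= lte_fin ltr_pM2r ?invr_gt0// ltr_nat ltnSn.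
by rewrite -EFinD -mulrBl -natr1 addrC addKr mul1r.
Qed.

Variable s : nat.
Local Notation C := {ffun 'I_s -> 'I_(b ^ m)}.

Definition cellbox (p : C) : set (s.-tuple R) := tbox (fun j => cell_itv (p j)).

Definition cellof (x : s.-tuple R) : 'I_s -> nat := fun j => cell1 b m (tnth x j).

Lemma measurable_cellbox p : measurable (cellbox p).
Proof. by apply: measurable_tbox => j; exact: measurable_itv. Qed.

Lemma measure_cellbox p : tuple_lebesgue s (cellbox p) = ((b%:R ^+ (m * s))^-1)%:E.
Proof.
rewrite (@tuple_lebesgue_tbox _ _ (fun=> (b%:R ^+ m)^-1)).
- by rewrite prodr_const card_ord -exprVn -exprM exprVn.
- by move=> j; exact: measurable_itv.
- by move=> j; exact: lebesgue_cell_itv.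
Qed.

Lemma cellboxP p x : cellbox p x <-> cube s x /\ forall j, cellof x j = p j.
Proof.
split=> [h|[cx h] j].
  by split=> j; have /cell_itvP[] := h j.
by apply/(cell_itvP _ (ltn_ord (p j))); split; [exact: cx|exact: h].
Qed.

Lemma cellof_lt x j : cube s x -> (cellof x j < b ^ m)%N.
Proof. by move=> cx; apply: cell1_lt. Qed.

Lemma cellbox_ex x : cube s x -> exists p, cellbox p x.
Proof.
move=> cx; exists [ffun j => Ordinal (cellof_lt j cx)].
by apply/cellboxP; split => // j; rewrite ffunE.
Qed.

Lemma trivIset_cellbox : trivIset setT cellbox.
Proof.
move=> p q _ _ [x [/cellboxP[_ hp] /cellboxP[_ hq]]].
by apply/ffunP => j; apply/val_inj; rewrite /= -hp -hq.
Qed.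

Lemma cube_cellbox : cube s = \bigcup_(p in [set: C]) cellbox p.
Proof.
apply/seteqP; split=> [x /cellbox_ex[p px]|x [p _ /cellboxP[]]//].
by exists p.
Qed.

Definition cellbox2 (pq : C * C) := cellbox pq.1 `*` cellbox pq.2.

Lemma measurable_cellbox2 pq : measurable (cellbox2 pq).
Proof. by apply: measurableX; exact: measurable_cellbox. Qed.

Lemma trivIset_cellbox2 : trivIset setT cellbox2.
Proof.
move=> [p q] [p' q'] _ _ [[x y] [[/= h1 h2] [/= h3 h4]]].
by congr (_, _); apply: trivIset_cellbox => //; [exists x|exists y].
Qed.

Local Notation mu2 := (tuple_lebesgue s \x tuple_lebesgue s)%E.

Lemma measure_cellbox2 pq : mu2 (cellbox2 pq) = ((b%:R ^+ (m * s))^-1 ^+ 2 : R)%:E.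
Proof.
rewrite /cellbox2 product_measure1E//; try exact: measurable_cellbox.
by rewrite expr2 EFinM; congr (_ * _)%E; exact: measure_cellbox.
Qed.

Definition goodpair (i : s.-tuple nat) (pq : C * C) : bool :=
  [forall j, agree b m (tnth i j) (pq.1 j) (pq.2 j)
          && ~~ agree b m (tnth i j).+1 (pq.1 j) (pq.2 j)].

Lemma common_digits_agree (x y : R) i : (i < m)%N -> 0 <= x < 1 -> 0 <= y < 1 ->
  common_digits b x y i <->
  agree b m i (cell1 b m x) (cell1 b m y) && ~~ agree b m i.+1 (cell1 b m x) (cell1 b m y).
Proof.
move=> im /andP[x0 _] /andP[y0 _].
have floorE k : (k <= m)%N ->
    (Num.floor (b%:R ^+ k * x) = Num.floor (b%:R ^+ k * y)) <->
    agree b m k (cell1 b m x) (cell1 b m y).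
  move=> km; rewrite /agree !(cell1_div pb)// /nfloor.
  split=> [->//|/eqP h]; have bk : 0 <= b%:R ^+ k :> R by rewrite exprn_ge0.
  by rewrite -[LHS]gez0_abs ?floor_ge0 ?mulr_ge0// h gez0_abs// floor_ge0 mulr_ge0.
rewrite /common_digits; split=> [[h1 h2]|/andP[h1 h2]].
  apply/andP; split; first by apply/floorE => //; exact: ltnW.
  by apply/negP => h; apply: h2; exact/floorE.
split; first by apply/floorE => //; exact: ltnW.
by move=> h; move/negP: h2; apply; exact/floorE.
Qed.

(** With every i_j < m, the condition gamma = i_j is decided by the first m digits, hence is
    constant on pairs of cells. *)
Lemma Dset_cellbox2 (i : s.-tuple nat) : (forall j, tnth i j < m)%N ->
  Dset b i = \bigcup_(pq in [set pq | goodpair i pq]) cellbox2 pq.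
Proof.
move=> im; apply/seteqP; split=> [[x y] [/= cx cy h]|[x y] [[p q] /= /forallP g [/=]]].
  have [p px] := cellbox_ex cx; have [q qy] := cellbox_ex cy.
  exists (p, q) => //=; apply/forallP => j /=.
  have /cellboxP[_ hp] := px; have /cellboxP[_ hq] := qy.
  by rewrite -hp -hq; apply/common_digits_agree => //.
move=> /cellboxP[cx hp] /cellboxP[cy hq]; split => // j.
by apply/common_digits_agree => //; rewrite -/(cellof x j) -/(cellof y j) hp hq; exact: g.
Qed.

End Boxes.

(** * The law of a scrambled pair *)

Section CombinatorialNet.
Variables (R : realType) (b m s : nat).
Hypothesis pb : prime b.
Let b1 : (1 < b)%N. Proof. exact: prime_gt1. Qed.
Variable V : 'I_(b ^ m) -> s.-tuple R.
Hypothesis Vnet : is_net V.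

Definition netcell (l : 'I_(b ^ m)) : 'I_s -> nat := cellof b m (V l).

Lemma netcell_lt l j : (netcell l j < b ^ m)%N.
Proof. by apply: cellof_lt => //; case: Vnet. Qed.

(** The index tuple is that of the interval containing [x]; this is how a statement about intervals
    becomes one about pairs of points. *)
Lemma elementary_interval_agree (k : s.-tuple nat) (x y : s.-tuple R) :
  cube s x -> cube s y -> (forall j, tnth k j <= m)%N ->
  elementary_interval b k [tuple nfloor (b%:R ^+ tnth k j * tnth x j) | j < s] y =
  [forall j, agree b m (tnth k j) (cellof b m x j) (cellof b m y j)].
Proof.
move=> cx cy km; apply: eq_forallb => j; rewrite tnth_mktuple.
have /andP[x0 _] := cx j; have /andP[y0 _] := cy j.
have bk : 0 < b%:R ^+ tnth k j :> R by rewrite exprn_gt0// ltr0n ltnW.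
rewrite /agree /cellof !(cell1_div pb)// ler_pdivrMr// ltr_pdivlMr// [_ * b%:R ^+ _]mulrC.
apply/idP/eqP => [h|->]; last by apply/nfloorP => //; rewrite mulr_ge0// ltW.
by apply/esym/nfloorP => //; rewrite mulr_ge0// ltW.
Qed.

Lemma netcell_count (k : 'I_s -> nat) : (\sum_j k j <= m)%N -> forall l0,
  #|[pred l | [forall j, agree b m (k j) (netcell l0 j) (netcell l j)]]| =
  (b ^ (m - \sum_j k j))%N.
Proof.
move=> km l0; have [Vc Ve] := Vnet.
pose kt := [tuple k j | j < s].
have kE : sumk kt = (\sum_j k j)%N by apply: eq_bigr => j _; rewrite tnth_mktuple.
have kj j : (tnth kt j <= m)%N.
  by apply: leq_trans km; rewrite tnth_mktuple (bigD1 j)//= leq_addr.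
have := Ve kt; rewrite kE => /(_ km [tuple nfloor (b%:R ^+ tnth kt j * tnth (V l0) j) | j < s]).
rewrite kE (subzn km) -exprnP -natrX => h.
have {}h : #|[pred l | elementary_interval b kt
   [tuple nfloor (b%:R ^+ tnth kt j * tnth (V l0) j) | j < s] (V l)]|%:R
   = (b ^ (m - \sum_j k j))%:R :> R.
  apply: h => j; rewrite tnth_mktuple; have /andP[x0 x1] := Vc l0 j.
  by apply: (@cell1_lt _ b (tnth kt j)) => //; apply/andP.
apply/eqP; rewrite -(eqr_nat R) -h; apply/eqP; congr (_%:R); apply: eq_card => l.
rewrite !inE elementary_interval_agree//.
by apply: eq_forallb => j; rewrite tnth_mktuple.
Qed.

Lemma netcell_neq l0 l j : l0 != l -> netcell l0 j != netcell l j.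
Proof. exact: (net_distinct netcell_lt netcell_count). Qed.

End CombinatorialNet.

Section PairLaw.
Context d (Omega : measurableType d) (R : realType) (P : probability Omega R).
Variables (b m s : nat).
Hypothesis pb : prime b.
Let b1 : (1 < b)%N. Proof. exact: prime_gt1. Qed.
Local Notation C := {ffun 'I_s -> 'I_(b ^ m)}.
Local Notation mu2 := (tuple_lebesgue s \x tuple_lebesgue s)%E.
Local Notation T := (s.-tuple R).
Local Notation cb := (@cellbox2 R b m s).

Lemma mu2_cell_fin (A : set (T * T)) (pq : C * C) : measurable A ->
  (mu2 (A `&` cb pq) \is a fin_num).
Proof.
move=> mA; have mc := @measurable_cellbox2 R b m s pq.
rewrite ge0_fin_numE ?measure_ge0//; apply: (@le_lt_trans _ _ (mu2 (cb pq))).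
  by apply: le_measure; rewrite ?inE//; exact: measurableI.
by rewrite measure_cellbox2// ltry.
Qed.

Lemma goodpair_density1 (i : s.-tuple nat) (pq : C * C) :
  \prod_j density1 b m (tnth i j) (pq.1 j) (pq.2 j) =
  (\prod_j (b%:R ^+ (tnth i j).+1 / (b%:R - 1))) * (goodpair i pq)%:R :> R.
Proof.
rewrite big_split /=; congr (_ * _); rewrite /goodpair.
case: forallP => [h|/forallP]; first by rewrite big1// => j _; rewrite h.
by rewrite negb_forall => /existsP[j /negPf h]; rewrite (bigD1 j)//= h mul0r.
Qed.

Lemma sum_prod_density1 (i : s.-tuple nat) : (forall j, tnth i j < m)%N ->
  \sum_(pq : C * C) \prod_j density1 b m (tnth i j) (pq.1 j) (pq.2 j) =
  (b%:R ^+ (m * s)) ^+ 2 :> R.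
Proof.
move=> im; rewrite -(pair_bigA _ (fun p q : C => \prod_j density1 b m (tnth i j) (p j) (q j)))/=.
rewrite (eq_bigr (fun=> b%:R ^+ (m * s))) => [|p _].
  by rewrite sumr_const card_ffun !card_ord -[LHS]mulr_natl natrX natrX -exprM expr2.
rewrite -(bigA_distr_bigA (fun j (q : 'I_(b ^ m)) => density1 b m (tnth i j) (p j) q)) /=.
under eq_bigr => j _ do rewrite sum_density1//.
by rewrite prodr_const card_ord exprM.
Qed.

(** The uniform law on D_i has the constant density 1 / mu2(D_i) on a union of cell pairs, and the
    product of the [density1] is that step function. *)
Lemma uniform_Dset_law (X : Omega -> T * T) (i : s.-tuple nat) :
  (forall j, tnth i j < m)%N -> uniform_on P mu2 X (Dset b i) ->
  forall A, measurable A -> P (X @^-1` A) =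
   (\sum_(pq : C * C) \prod_j density1 b m (tnth i j) (pq.1 j) (pq.2 j)
      * fine (mu2 (A `&` cb pq)))%:E.
Proof.
move=> im Xu A mA; rewrite Xu//; congr (_%:E).
have muD B : measurable B -> fine (mu2 (B `&` Dset b i)) =
    \sum_(pq | goodpair i pq) fine (mu2 (B `&` cb pq)).
  move=> mB; rewrite (Dset_cellbox2 R pb im) measure_setI_bigcup//.
  - rewrite -[RHS]/(fine (_%:E)) -sumEFin; congr fine; apply: eq_bigr => pq _.
    by rewrite fineK// mu2_cell_fin.
  - by move=> pq; exact: measurable_cellbox2.
  - exact: trivIset_cellbox2.
set K := \prod_j (b%:R ^+ (tnth i j).+1 / (b%:R - 1)) : R.
have bn0 := b_neq0 R b1; have b10 := bB1_neq0 R b1.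
have K0 : K != 0.
  by apply/prodf_neq0 => j _; rewrite mulf_neq0 ?invr_eq0 ?expf_neq0.
(* The volume is read off from the total mass: the function equal to K on D_i and 0 elsewhere
   integrates to 1 by [sum_prod_density1]. *)
have -> : fine (mu2 (Dset b i)) = K^-1.
  rewrite -[Dset b i]setTI muD//.
  have N0 : b%:R ^+ (m * s) != 0 :> R by rewrite expf_neq0.
  apply: (mulfI K0); rewrite mulfV// mulr_sumr.
  transitivity ((b%:R ^+ (m * s))^-1 ^+ 2 *
     \sum_(pq : C * C) \prod_j density1 b m (tnth i j) (pq.1 j) (pq.2 j) : R).
    rewrite mulr_sumr big_mkcond; apply: eq_bigr => pq _.
    rewrite goodpair_density1 -/K setTI measure_cellbox2//=.
    by case: ifP; rewrite ?mulr1 ?mulr0// mulrC.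
  by rewrite sum_prod_density1// -exprMn mulVf// expr1n.
rewrite muD// invrK mulrC mulr_sumr big_mkcond; apply: eq_bigr => pq _.
by rewrite goodpair_density1 -/K; case: ifP; rewrite ?mulr1 ?mulr0 ?mul0r.
Qed.

Variable U : 'I_(b ^ m) -> {RV P >-> T}.
Hypothesis m1 : (1 <= m)%N.
Let n1 : (1 < b ^ m)%N.
Proof. by rewrite (leq_trans b1)// -[X in (X <= _)%N]expn1 leq_pexp2l// ltnW. Qed.

(** Distinct net points have fewer than m common digits in each coordinate, so the pair lies in some
    D_i with all i_j < m, a union of cell pairs. *)
Lemma scrambled_pair_law (V : 'I_(b ^ m) -> T) : is_net V ->
  (forall (l j : 'I_(b ^ m)) (i : s.-tuple nat), l != j ->
     Dset b i (V l, V j) ->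
     uniform_on P mu2 (fun w => (U l w, U j w)) (Dset b i)) ->
  forall l0 l, l0 != l -> forall A, measurable A ->
  P [set w | A (U l0 w, U l w)] =
   (\sum_(pq : C * C) \prod_j
       density1 b m (ncommon b m (netcell V l0 j) (netcell V l j)) (pq.1 j) (pq.2 j)
      * fine (mu2 (A `&` cb pq)))%:E.
Proof.
move=> Vn hU l0 l ne A mA.
pose i := [tuple ncommon b m (netcell V l0 j) (netcell V l j) | j < s].
have iE j : tnth i j = ncommon b m (netcell V l0 j) (netcell V l j) by rewrite tnth_mktuple.
have nl l' j := netcell_lt pb Vn l' j.
have nn j := netcell_neq pb Vn j ne.
have im j : (tnth i j < m)%N by rewrite iE ncommon_ltn.
have Vc := Vn.1.
have Di : Dset b i (V l0, V l).
  split => [||j]; [exact: Vc|exact: Vc|apply/(common_digits_agree pb (im j) (Vc l0 j) (Vc l j))].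
  rewrite -[cell1 b m (tnth (V l0) j)]/(netcell V l0 j)
    -[cell1 b m (tnth (V l) j)]/(netcell V l j).
  by rewrite !agree_ncommon// -?iE ?leqnn ?ltnn// ltnW.
rewrite (uniform_Dset_law im (hU _ _ _ ne Di) mA); congr (_%:E).
apply: eq_bigr => pq _; congr (_ * _).
by apply: eq_bigr => j _; rewrite iE.
Qed.

End PairLaw.

(** * The random pair of indices *)

Section RandomPair.
Context d d' (Omega : measurableType d) (T : measurableType d') (R : realType)
  (P : probability Omega R) (n : nat).
Variables (U : 'I_n -> {RV P >-> T}) (I J : Omega -> 'I_n).
Hypothesis n1 : (1 < n)%N.
Hypothesis hIJ : random_distinct_pair P (fun l w => U l w) I J.

Let ev (ij : 'I_n * 'I_n) : set Omega := [set w | I w = ij.1 /\ J w = ij.2].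

Let mev ij : measurable (ev ij).
Proof.
have [mI mJ _] := hIJ.
have -> : ev ij = I @^-1` [set ij.1] `&` J @^-1` [set ij.2] by [].
by apply: measurableI.
Qed.

Let tev : trivIset setT ev.
Proof. by move=> [i j] [i' j'] _ _ [w [[/= <- <-] [/= <- <-]]]. Qed.

Let evT : \bigcup_(ij in [set ij | xpredT ij]) ev ij = setT.
Proof. by apply/seteqP; split => // w _; exists (I w, J w). Qed.

Let mpair i j (A : set (T * T)) : measurable A ->
  measurable [set w | A (U i w, U j w)].
Proof.
move=> mA; rewrite -[X in measurable X]setTI.
exact: (measurable_fun_pair (measurable_funP (U i)) (measurable_funP (U j))).
Qed.

Let c : R := (n%:R * (n%:R - 1))^-1.

Let Pev i j (A : set (T * T)) : i != j -> measurable A ->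
  P ([set w | A (U i w, U j w)] `&` ev (i, j)) = (c%:E * P [set w | A (U i w, U j w)])%E.
Proof.
move=> ij mA; have [_ _ h] := hIJ.
(* Independence is stated for events on the whole tuple of points, so [A] is pulled back along two
   coordinates. *)
pose A' : set (n.-tuple T) := [set t | A (tnth t i, tnth t j)].
have mA' : measurable A'.
  rewrite -[X in measurable X]setTI.
  exact: (measurable_fun_pair (measurable_tnth i) (measurable_tnth j)).
have -> : [set w | A (U i w, U j w)] = [set w | A' [tuple U l w | l < n]].
  by apply/seteqP; split => w; rewrite /A' /= !tnth_mktuple.
rewrite setIC h//; congr (_%:E * _)%E.
by rewrite /c natrM -subn1 natrB// ltnW.
Qed.

(** The n (n - 1) off-diagonal events have probability 1 / (n (n - 1)) each and exhaust the total
    mass. *)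
Lemma random_pair_diag i : P (ev (i, i)) = 0%E.
Proof.
have n0 : n%:R != 0 :> R by rewrite pnatr_eq0; lia.
have n10 : n%:R - 1 != 0 :> R by rewrite subr_eq0 pnatr_eq1; lia.
have : P setT = \sum_ij P (setT `&` ev ij) :> \bar R.
  by rewrite -measure_setI_bigcup// evT setTI.
rewrite probability_setT -(pair_bigA _ (fun i j => P (setT `&` ev (i, j))))/=.
rewrite (eq_bigr (fun i => P (ev (i, i)) + ((n%:R - 1) * c)%:E)%E); last first.
  move=> i' _; rewrite (bigD1 i')//= setTI; congr (_ + _)%E.
  rewrite (eq_bigr (fun=> c%:E)) => [|j ij].
    rewrite sumEFin sumr_const (@eq_card _ _ (predC1 i')) => [|l]; last by rewrite !inE.
    by rewrite cardC1 card_ord -subn1 -[c *+ _]mulr_natl natrB// ltnW.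
  rewrite -[setT]/[set w | setT (U i' w, U j w)] Pev//; last by rewrite eq_sym.
  by rewrite -[[set w | _]]/setT probability_setT mule1.
rewrite big_split /= sumEFin sumr_const card_ord.
rewrite -[_ *+ n]mulr_natl mulrA /c mulfV ?mulf_neq0//.
have Pf : P (ev (i, i)) \is a fin_num by exact: fin_num_measure.
rewrite (bigD1 i)//=.
have : (0 <= \sum_(i' < n | i' != i) P (ev (i', i')))%E by apply: sume_ge0.
have : (0 <= P (ev (i, i)))%E by [].
have : (\sum_(i' < n | i' != i) P (ev (i', i')))%E \is a fin_num.
  by apply/sum_fin_numP => i' _ _; exact: fin_num_measure.
move: (\sum_(i' < n | i' != i) P (ev (i', i')))%E (P (ev (i, i))) Pf => y x.
case: x => // x _; case: y => // y _; rewrite !lee_fin => x0 y0.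
by case=> e; congr (_%:E); lra.
Qed.

Lemma measurable_random_pair (A : set (T * T)) : measurable A ->
  measurable [set w | A (U (I w) w, U (J w) w)].
Proof.
move=> mA; have -> : [set w | A (U (I w) w, U (J w) w)] =
  \bigcup_(ij in [set: 'I_n * 'I_n]) ([set w | A (U ij.1 w, U ij.2 w)] `&` ev ij).
  apply/seteqP; split=> [w Aw|w [[i j] _ [/= Aw [/= -> ->]]]]//.
  by exists (I w, J w).
apply: fin_bigcup_measurable; first exact: finite_finset.
by move=> ij _; apply: measurableI; [exact: mpair|exact: mev].
Qed.

Lemma random_pair_law (A : set (T * T)) : measurable A ->
  P [set w | A (U (I w) w, U (J w) w)] =
  \sum_i \sum_(j | i != j) (c%:E * P [set w | A (U i w, U j w)])%E :> \bar R.
Proof.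
move=> mA; have mAp := measurable_random_pair mA.
rewrite -[X in P X]setIT -evT measure_setI_bigcup//.
rewrite -(pair_bigA _ (fun i j => P ([set w | A (U (I w) w, U (J w) w)] `&` ev (i, j))))/=.
apply: eq_bigr => i _; rewrite (bigD1 i)//=.
have -> : P ([set w | A (U (I w) w, U (J w) w)] `&` ev (i, i)) = 0%E.
  apply/eqP; rewrite -measure_le0 -(random_pair_diag i).
  by apply: le_measure; rewrite ?inE//; exact: measurableI.
rewrite add0e (eq_bigl (fun j => i != j)) => [|j]; last by rewrite eq_sym.
apply: eq_bigr => j ij; rewrite -Pev//; congr (P _).
by apply/seteqP; split=> w [/= + [/= e1 e2]]; rewrite e1 e2.
Qed.

End RandomPair.

(** * Expectations over the random pair *)

Section PairExpectation.
Context d (Omega : measurableType d) (R : realType) (P : probability Omega R).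
Variables (b m s : nat).
Hypotheses (pb : prime b) (m1 : (1 <= m)%N).
Let b1 : (1 < b)%N. Proof. exact: prime_gt1. Qed.
Let n1 : (1 < b ^ m)%N.
Proof. by rewrite (leq_trans b1)// -[X in (X <= _)%N]expn1 leq_pexp2l// ltnW. Qed.
Local Notation C := {ffun 'I_s -> 'I_(b ^ m)}.
Local Notation mu := (tuple_lebesgue s).
Local Notation mu2 := (tuple_lebesgue s \x tuple_lebesgue s)%E.
Local Notation T := (s.-tuple R).
Local Notation cb := (@cellbox2 R b m s).
Local Notation cell := (@cellbox R b m s).
Variable U : 'I_(b ^ m) -> {RV P >-> T}.
Hypothesis Ucube : forall l w, cube s (U l w).
Variable V : 'I_(b ^ m) -> T.
Hypothesis Vnet : is_net V.
Hypothesis UV : forall (l j : 'I_(b ^ m)) (i : s.-tuple nat), l != j ->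
  Dset b i (V l, V j) -> uniform_on P mu2 (fun w => (U l w, U j w)) (Dset b i).
Variables I J : Omega -> 'I_(b ^ m).
Hypothesis hIJ : random_distinct_pair P (fun l w => U l w) I J.

Let h (pq : C * C) : R := cell_density R (netcell V) pq.1 pq.2.

Let h_ge0 pq : 0 <= h pq.
Proof.
rewrite /h /cell_density mulr_ge0 ?invr_ge0 ?mulr_ge0 ?subr_ge0 ?ler1n ?(ltnW n1)//.
apply: sumr_ge0 => l0 _; apply: sumr_ge0 => l _; apply: prodr_ge0 => j _.
by rewrite /density1 mulr_ge0// divr_ge0 ?exprn_ge0// subr_ge0 ler1n ltnW.
Qed.

Let X w : T * T := (U (I w) w, U (J w) w).

Let mX : measurable_fun setT X.
Proof. by move=> _ A mA; rewrite setTI; exact: (measurable_random_pair hIJ). Qed.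

HB.instance Definition _ := isMeasurableFun.Build _ _ _ _ X mX.

Let XRV : {RV P >-> (T * T)%type} := X.

(** Averaging the laws of the pairs and exchanging the sums collects [cell_density] on each pair of
    cells. *)
Let lawX A : measurable A -> distribution P XRV A =
  (\sum_pq (h pq)%:E * mu2 (A `&` cb pq))%E.
Proof.
move=> mA; rewrite -[LHS]/(P [set w | A (U (I w) w, U (J w) w)]).
rewrite (random_pair_law n1 hIJ)//.
rewrite (eq_bigr (fun pq => (h pq * fine (mu2 (A `&` cb pq)))%:E)); last first.
  by move=> pq _; rewrite [RHS]EFinM fineK// mu2_cell_fin.
rewrite [RHS]sumEFin.
pose Q i j : R := ((b ^ m)%:R * ((b ^ m)%:R - 1))^-1 *
   \sum_(pq : C * C) \prod_j'
       density1 b m (ncommon b m (netcell V i j') (netcell V j j')) (pq.1 j') (pq.2 j')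
      * fine (mu2 (A `&` cb pq)).
rewrite (eq_bigr (fun i => (\sum_(j | i != j) Q i j)%:E)); last first.
  move=> i _; rewrite -sumEFin; apply: eq_bigr => j ij.
  by rewrite (scrambled_pair_law pb Vnet UV ij mA) -EFinM.
rewrite sumEFin; congr (_%:E); rewrite /Q.
under eq_bigr do rewrite -mulr_sumr exchange_big /=.
rewrite -mulr_sumr exchange_big /= mulr_sumr; apply: eq_bigr => pq _.
rewrite /h /cell_density -mulrA; congr (_ * _); rewrite mulr_suml; apply: eq_bigr => i _.
by rewrite mulr_suml.
Qed.

(** The law of the pair is a mixture of restrictions of Lebesgue measure to products of two cells,
    and on each product Fubini separates [u] from [v]. *)
Lemma pair_expectation (u v : T -> R) :
  mu.-integrable (cube s) (EFin \o u) -> mu.-integrable (cube s) (EFin \o v) ->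
  P.-integrable setT (EFin \o (fun w => u (U (I w) w) * v (U (J w) w))) /\
  \int[P]_w (u (U (I w) w) * v (U (J w) w)) =
  \sum_(p : C) \sum_(q : C) cell_density R (netcell V) p q *
     ((\int[mu]_(x in cell p) u x) * (\int[mu]_(x in cell q) v x)).
Proof.
(* [u] and [v] are controlled only on the cube. All points lie there, so the extensions by zero take
   the same values at them and are measurable everywhere. *)
move=> iu iv; pose u' := u \_ (cube s); pose v' := v \_ (cube s).
have mc : measurable (@cube R s) by exact: measurable_unit_cube.
have mu' : measurable_fun setT u'.
  by apply/measurable_EFinP; rewrite /u' -restrict_EFin;
    apply: (measurable_int mu); apply/(integrable_mkcond _ mc).
have mv' : measurable_fun setT v'.
  by apply/measurable_EFinP; rewrite /v' -restrict_EFin;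
    apply: (measurable_int mu); apply/(integrable_mkcond _ mc).
pose g (z : T * T) := u' z.1 * v' z.2.
have mg : measurable_fun setT g.
  apply: measurable_funM.
    exact: measurableT_comp mu' measurable_fst.
  exact: measurableT_comp mv' measurable_snd.
have gX w : g (X w) = u (U (I w) w) * v (U (J w) w).
  by rewrite /g /X /u' /v' /patch /= !mem_set//; exact: Ucube.
have sub (p : C) : cell p `<=` cube s by move=> x /(cellboxP pb)[].
have prodI (pq : C * C) : mu2.-integrable (cb pq) (EFin \o g) /\
    \int[mu2]_(z in cb pq) g z =
    (\int[mu]_(x in cell pq.1) u x) * (\int[mu]_(x in cell pq.2) v x).
  have mp := @measurable_cellbox R b m s pq.1; have mq := @measurable_cellbox R b m s pq.2.
  have iu1 : mu.-integrable (cell pq.1) (EFin \o u).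
    exact: (integrableS mc mp (sub _)).
  have iv1 : mu.-integrable (cell pq.2) (EFin \o v).
    exact: (integrableS mc mq (sub _)).
  have [i1 i2] := integral_prod_mul mp mq iu1 iv1.
  have gE : {in cb pq, (fun z => u z.1 * v z.2) =1 g}.
    move=> [x y]; rewrite inE => -[/= /sub cx /sub cy].
    by rewrite /g /u' /v' /patch /= !mem_set.
  split; last by rewrite -i2; apply: eq_Rintegral => z zc; rewrite gE.
  have mcb : measurable (cb pq) by exact: measurable_cellbox2.
  by apply: (@eq_integrable _ _ _ mu2 (cb pq) mcb _ _ _ i1) => z zc; rewrite /= gE.
have cz : C by exact: [ffun=> Ordinal (ltnW n1)].
have [ig Eg] := @integral_mixture _ _ _ mu2 _ (cz, cz) h cb h_ge0
   (@measurable_cellbox2 R b m s) _ lawX g mg (fun pq => (prodI pq).1).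
have mEg : measurable_fun setT (EFin \o g) by exact/measurable_EFinP.
have iP : P.-integrable setT ((EFin \o g) \o XRV).
  apply/integrableP; split; first exact: measurableT_comp mEg mX.
  have /integrableP[_] := ig.
  rewrite ge0_integral_distribution//; exact: measurableT_comp mEg.
have fE : (EFin \o g) \o XRV = EFin \o (fun w => u (U (I w) w) * v (U (J w) w)).
  by apply/funext => w /=; rewrite -gX.
split; first by rewrite -fE.
transitivity (\int[distribution P XRV]_z g z).
  rewrite /Rintegral integral_distribution//; congr fine.
  by apply: eq_integral => w _; rewrite /= -gX.
rewrite Eg.
rewrite [RHS]pair_bigA /=; apply: eq_bigr => pq _.
by rewrite (prodI pq).2.
Qed.

End PairExpectation.

(** * Integrals over the cube as sums over cells *)

Section CubeIntegrals.
Variables (R : realType) (s : nat).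
Local Notation mu := (tuple_lebesgue s).
Local Notation T := (s.-tuple R).

Let mc : measurable (@cube R s). Proof. exact: measurable_unit_cube. Qed.

Lemma integrable_cst_cube (r : R) : mu.-integrable (cube s) (EFin \o (fun=> r)).
Proof.
apply/integrableP; split; first exact: measurable_cst.
rewrite [X in (X < _)%E](_ : _ = \int[mu]_(x in cube s) (`|r|%:E))%E; last first.
  by apply: eq_integral.
by rewrite integral_cst// [X in (_ * X)%E](_ : _ = 1%E) ?mule1 ?ltry//; exact: tuple_lebesgue_cube.
Qed.

(** The cube has finite measure, and |x| <= 1 + x^2 + y^2 bounds either part of [f]. *)
Lemma L2cube_integrable (f : T -> R[i]) : L2cube f ->
  mu.-integrable (cube s) (EFin \o (fun x => complex.Re (f x))) /\
  mu.-integrable (cube s) (EFin \o (fun x => complex.Im (f x))).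
Proof.
move=> [mRe mIm l2].
have i2 : mu.-integrable (cube s)
    (EFin \o (fun x => 1 + (complex.Re (f x) ^+ 2 + complex.Im (f x) ^+ 2))).
  have -> : EFin \o (fun x => 1 + (complex.Re (f x) ^+ 2 + complex.Im (f x) ^+ 2)) =
    ((EFin \o (fun=> 1%R)) \+
     (EFin \o (fun x => (complex.Re (f x) ^+ 2 + complex.Im (f x) ^+ 2)%R)))%E.
    by apply/funext => x /=; rewrite EFinD.
  apply: integrableD => //; first exact: integrable_cst_cube.
  apply/integrableP; split.
    by apply/measurable_EFinP; apply: measurable_funD; exact: measurable_funX.
  apply: le_lt_trans l2; rewrite le_eqVlt; apply/orP; left; apply/eqP.
  by apply: eq_integral => x _ /=; rewrite ger0_norm// addr_ge0// sqr_ge0.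
have sq (x y : R) : `|x| <= 1 + (x ^+ 2 + y ^+ 2).
  have h1 : 0 <= (`|x| - 1) ^+ 2 by exact: sqr_ge0.
  have h2 : `|x| ^+ 2 = x ^+ 2 by exact: real_normK (num_real _).
  have h3 : 0 <= y ^+ 2 by exact: sqr_ge0.
  have h4 := sqr_ge0 x.
  by rewrite -h2 in h4 *; nra.
split; apply: (le_integrable mc _ _ i2); rewrite ?measurable_EFinP// => x _ /=;
  rewrite lee_fin [leRHS]ger0_norm ?addr_ge0 ?sqr_ge0//.
by rewrite [X in 1 + X]addrC.
Qed.

End CubeIntegrals.

Section CellIntegrals.
Variables (R : realType) (b m s : nat).
Hypothesis pb : prime b.
Let b1 : (1 < b)%N. Proof. exact: prime_gt1. Qed.
Local Notation C := {ffun 'I_s -> 'I_(b ^ m)}.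
Local Notation mu := (tuple_lebesgue s).
Local Notation T := (s.-tuple R).
Local Notation cell := (@cellbox R b m s).

Lemma Rintegral_cube_cells (g : T -> R) : measurable_fun (cube s) g ->
  (forall p : C, mu.-integrable (cell p) (EFin \o g)) ->
  \int[mu]_(x in cube s) g x = \sum_(p : C) \int[mu]_(x in cell p) g x.
Proof.
move=> mg ig.
have E : cube s = \big[setU/set0]_(p <- index_enum C) cell p.
  rewrite (@cube_cellbox R b m pb s) -bigcup_seq; apply: eq_bigcupl.
  by split => p _ //=; exact: mem_index_enum.
rewrite /Rintegral E integral_bigsetU_EFin.
- rewrite -[RHS]/(fine (_%:E)) -sumEFin; congr fine; apply: eq_bigr => p _.
  by rewrite fineK//; apply: integrable_fin_num => //; exact: measurable_cellbox.
- by move=> p; exact: measurable_cellbox.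
- exact: index_enum_uniq.
- by move=> p q _ _; apply: trivIset_cellbox.
- by rewrite -E; exact/measurable_EFinP.
Qed.

Lemma measurable_fun_cells (g : T -> R) :
  (forall p : C, measurable_fun (cell p) g) -> measurable_fun (cube s) g.
Proof.
move=> mg; rewrite (@cube_cellbox R b m pb s) => _ Y mY; rewrite setI_bigcupl.
apply: fin_bigcup_measurable; first exact: finite_finset.
by move=> p _; apply: mg => //; exact: measurable_cellbox.
Qed.

Definition cellint (f : T -> R[i]) (p : C) : R[i] :=
  (\int[mu]_(x in cell p) complex.Re (f x)) +i* (\int[mu]_(x in cell p) complex.Im (f x)).

(** The finite type [C] serves twice, for the cells and for the frequencies with all l_j < b^m; this
    reads an element as a frequency. *)
Definition ltuple (l : C) : s.-tuple nat := [tuple (l j : nat) | j < s].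

Lemma wal_cell (l p : C) x : cell p x ->
  wal b (ltuple l) x = \prod_j cell_wal R b m (l j) (p j).
Proof.
move=> /(cellboxP pb)[cx h]; apply: eq_bigr => j _.
have /andP[x0 _] := cx j.
by rewrite tnth_mktuple (wal1_cell1 (m := m) pb)// -(h j).
Qed.

Lemma Rintegral_lin (D : set T) (f g : T -> R) (x y : R) : measurable D ->
  mu.-integrable D (EFin \o f) -> mu.-integrable D (EFin \o g) ->
  mu.-integrable D (EFin \o (fun z => f z * x + g z * y)) /\
  \int[mu]_(z in D) (f z * x + g z * y) =
  \int[mu]_(z in D) f z * x + \int[mu]_(z in D) g z * y.
Proof.
move=> mD iF iG.
have iFx : mu.-integrable D (EFin \o (fun z => f z * x)).
  have -> : EFin \o (fun z => f z * x) = (fun z => x%:E * (EFin \o f) z)%E.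
    by apply/funext => z /=; rewrite mulrC EFinM.
  exact: integrableZl.
have iGy : mu.-integrable D (EFin \o (fun z => g z * y)).
  have -> : EFin \o (fun z => g z * y) = (fun z => y%:E * (EFin \o g) z)%E.
    by apply/funext => z /=; rewrite mulrC EFinM.
  exact: integrableZl.
split; last by rewrite RintegralD// !RintegralZr.
have -> : EFin \o (fun z => f z * x + g z * y) =
   ((EFin \o (fun z => (f z * x)%R)) \+ (EFin \o (fun z => (g z * y)%R)))%E.
  by apply/funext => z /=; rewrite EFinD.
exact: integrableD.
Qed.

(** At these frequencies the Walsh function is constant on each cell and leaves the integral. *)
Lemma walsh_coef_cells (f : T -> R[i]) (l : C) : L2cube f ->
  walsh_coef b f (ltuple l) = cell_walsh_coef (cellint f) l.
Proof.
move=> f2; have [iRe iIm] := L2cube_integrable f2.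
have mcell p : measurable (cell p) by exact: measurable_cellbox.
have sub (p : C) : cell p `<=` cube s by move=> x /(cellboxP pb)[].
have iR p := integrableS (@measurable_unit_cube R s) (mcell p) (sub p) iRe.
have iI p := integrableS (@measurable_unit_cube R s) (mcell p) (sub p) iIm.
pose w (p : C) := \prod_j cell_wal R b m (l j) (p j).
(* Real and imaginary parts of f wal^* are real combinations of Re f and Im f with coefficients
   constant on each cell, so one statement serves both. *)
have linint (g : T -> R) (x y : C -> R) :
    (forall p, {in cell p, g =1 (fun z => complex.Re (f z) * x p + complex.Im (f z) * y p)}) ->
    \int[mu]_(z in cube s) g z = \sum_p (\int[mu]_(z in cell p) complex.Re (f z) * x p
        + \int[mu]_(z in cell p) complex.Im (f z) * y p).
  move=> gE; have lin p := Rintegral_lin (x p) (y p) (mcell p) (iR p) (iI p).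
  have ig p : mu.-integrable (cell p) (EFin \o g).
    apply: (@eq_integrable _ _ _ mu (cell p) (mcell p) _ _ _ (lin p).1) => z zp.
    by rewrite /= (gE p).
  rewrite Rintegral_cube_cells//; last first.
    apply: measurable_fun_cells => p; apply/measurable_EFinP.
    exact: (measurable_int mu).
  by apply: eq_bigr => p _; rewrite -(lin p).2; apply: eq_Rintegral => z zp; rewrite (gE p).
rewrite /walsh_coef /Cintegral.
rewrite (linint _ (fun p => complex.Re (w p)) (fun p => complex.Im (w p))); last first.
  move=> p z; rewrite inE => zp; rewrite (wal_cell l zp) -/(w p).
  by case: (f z) (w p) => [a a'] [c c'] /=; ring.
rewrite (linint _ (fun p => - complex.Im (w p)) (fun p => complex.Re (w p))); last first.
  move=> p z; rewrite inE => zp; rewrite (wal_cell l zp) -/(w p).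
  by case: (f z) (w p) => [a a'] [c c'] /=; ring.
rewrite /cell_walsh_coef /cellint; apply/eqP; rewrite eq_complex /=; apply/andP; split; apply/eqP.
  rewrite raddf_sum /=; apply: eq_bigr => p _; rewrite -/(w p).
  by case: (w p) => c c' /=; ring.
rewrite raddf_sum /=; apply: eq_bigr => p _; rewrite -/(w p).
by case: (w p) => c c' /=; ring.
Qed.

Lemma Rintegral_cst_cell (p : C) : \int[mu]_(x in cell p) 1 = (b%:R ^+ (m * s))^-1 :> R.
Proof.
rewrite Rintegral_cst; last exact: measurable_cellbox.
by rewrite mul1r; exact: (congr1 fine (@measure_cellbox R b m pb s p)).
Qed.

End CellIntegrals.

(** * The covariance *)

(** Partial sums are constant from the moment the finite set contains [r]. *)
Lemma has_sum_finite (I : choiceType) (K : numFieldType) (D : set I) (g : I -> K)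
    (r : seq I) : uniq r -> (forall i, D i -> i \notin r -> g i = 0) ->
  has_sum D g (\sum_(i <- r | i \in D) g i).
Proof.
move=> ur g0; rewrite big_mkcond /=.
pose F (i : I) : K^o := if i \in D then g i else 0.
rewrite /has_sum -/F; change (partial_sum F @ totally --> (\sum_(i <- r) F i : K^o)).
have FF : Filter (@totally I) by have PF := @totally_filter I; exact: PF.
apply: (@cvg_near_cst _ _ _ _ _ FF).
change (totally [set B | partial_sum F B = \sum_(i <- r) F i]).
exists [fset x in r]%fset => // B /= rB.
rewrite /partial_sum -(big_seq_fsetE _ B predT F) /=.
rewrite -(@big_fset_incl _ _ _ _ [fset x in r]%fset B F rB).
  by apply: perm_big; apply: uniq_perm => // i; rewrite in_fset.
move=> i _; rewrite in_fset /F => ir; case: ifPn => //; rewrite inE => Di.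
exact: g0.
Qed.

(** * Finite supports of the two series *)

Section IndexSums.
Variables (R : realType) (b m s : nat).
Hypothesis b1 : (1 < b)%N.
Local Notation C := {ffun 'I_s -> 'I_(b ^ m)}.

(** The coordinate [j0] contributes at least m + 1 and every other nonzero one at least 1, so |k| >=
    m + r; hence c >= r and the sum is empty. *)
Lemma psi_hatk_eq0 (k : s.-tuple nat) (j0 : 'I_s) : (m < tnth k j0)%N ->
  psi_hatk b m k = 0 :> R.
Proof.
move=> mk; rewrite /psi_hatk.
set r := #|_|; suff -> : (r - (sumk k - m) = 0)%N by rewrite big_ord0 mulr0.
have : (m + r <= sumk k)%N; last by lia.
rewrite /r -sum1_card big_mkcond /sumk (bigD1 j0)//= [leqRHS](bigD1 j0)//=.
have : (\sum_(i < s | i != j0) (if i \in [pred j | tnth k j != 0%N] then 1 else 0)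
   <= \sum_(i < s | i != j0) tnth k i)%N.
  by apply: leq_sum => i _; rewrite inE; case: (tnth k i).
move: (\sum_(i < s | i != j0) _)%N (\sum_(i < s | i != j0) _)%N => x y xy.
by case: ifP => _; lia.
Qed.

Lemma ltuple_inj : injective (@ltuple b m s).
Proof.
move=> l l' e; apply/ffunP => j; apply/val_inj.
by have := congr1 (fun t => tnth t j) e; rewrite !tnth_mktuple.
Qed.

Definition lseq : seq (s.-tuple nat) := [seq ltuple l | l <- enum {: C}].

Lemma lseq_uniq : uniq lseq.
Proof. by rewrite map_inj_uniq ?enum_uniq//; exact: ltuple_inj. Qed.

Lemma mem_lseq (l : s.-tuple nat) : (forall j, tnth l j < b ^ m)%N -> l \in lseq.
Proof.
move=> lm; apply/mapP; exists [ffun j => Ordinal (lm j)]; first by rewrite mem_enum.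
by apply: eq_from_tnth => j; rewrite tnth_mktuple ffunE.
Qed.

Lemma psi_hat_eq0 (l : s.-tuple nat) : l \notin lseq -> psi_hat b m l = 0 :> R.
Proof.
move=> nl; have /existsP[j jP] : [exists j, b ^ m <= tnth l j]%N.
  rewrite -[X in is_true X]negbK negb_exists; apply: contra nl => /forallP H.
  by apply: mem_lseq => j; rewrite ltnNge.
by apply: (@psi_hatk_eq0 _ j); rewrite tnth_mktuple ltnNge up_log_succ_le// -leqNgt.
Qed.

Lemma Lindex_eq0 (l : s.-tuple nat) : (Lindex b l == zero_index s) = (l == zero_index s).
Proof.
apply/eqP/eqP => [e|->].
  apply: eq_from_tnth => j; have := congr1 (fun t => tnth t j) e.
  rewrite !tnth_mktuple => h; apply/eqP; rewrite -leqn0 -ltnS -[X in (_ < X)%N](expn0 b).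
  by rewrite -up_log_succ_le// h.
by apply: eq_from_tnth => j; rewrite !tnth_mktuple up_log1.
Qed.

Lemma Lindex_le (l : C) j : (tnth (Lindex b (ltuple l)) j <= m)%N.
Proof. by rewrite !tnth_mktuple up_log_succ_le. Qed.

Definition ktuple (k : {ffun 'I_s -> 'I_m.+1}) : s.-tuple nat := [tuple (k j : nat) | j < s].

Lemma ktuple_inj : injective ktuple.
Proof.
move=> l l' e; apply/ffunP => j; apply/val_inj.
by have := congr1 (fun t => tnth t j) e; rewrite !tnth_mktuple.
Qed.

Definition kseq : seq (s.-tuple nat) := [seq ktuple k | k <- enum {: {ffun 'I_s -> 'I_m.+1}}].

Lemma kseq_uniq : uniq kseq.
Proof. by rewrite map_inj_uniq ?enum_uniq//; exact: ktuple_inj. Qed.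

Lemma mem_kseq (k : s.-tuple nat) : (forall j, tnth k j <= m)%N -> k \in kseq.
Proof.
move=> km; apply/mapP; exists [ffun j => inord (tnth k j)]; first by rewrite mem_enum.
by apply: eq_from_tnth => j; rewrite tnth_mktuple ffunE inordK// ltnS.
Qed.

Lemma sigma2_lseq (f : s.-tuple R -> R[i]) (k : s.-tuple nat) :
  (forall j, tnth k j <= m)%N ->
  sigma2 b f k = \sum_(l <- lseq | Lindex b l == k) `|walsh_coef b f l| ^+ 2.
Proof.
move=> km; rewrite /sigma2 -[RHS]big_filter (@fsbigE _ _ _ _ _ [seq l <- lseq | Lindex b l == k]).
- rewrite big_seq_cond [RHS]big_seq; apply: eq_bigl => l.
  rewrite mem_filter; case: eqP => //= lk; apply/andP/idP => [[]//|ll]; split => //.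
  by rewrite inE; apply/LsetP.
- by rewrite filter_uniq// lseq_uniq.
- by move=> l /=; rewrite mem_filter => /andP[/eqP e _]; apply/LsetP.
- move=> l /(LsetP _ _ b1) e; rewrite mem_filter e eqxx/= mem_lseq// => j.
  by rewrite -up_log_succ_le//; have := km j; rewrite e tnth_mktuple.
Qed.

(** The sets L_k partition the frequencies, and psi_hat is constant on each of them. *)
Lemma sum_sigma2 (f : s.-tuple R -> R[i]) :
  \sum_(k <- kseq | k \in [set k : s.-tuple nat | k != zero_index s])
     sigma2 b f k * (psi_hatk b m k : R)%:C =
  \sum_(l <- lseq | l \in [set l : s.-tuple nat | l != zero_index s])
    `|walsh_coef b f l| ^+ 2 * (psi_hat b m l : R)%:C.
Proof.
have inN (k : s.-tuple nat) :
    (k \in [set k : s.-tuple nat | k != zero_index s]) = (k != zero_index s).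
  by apply/idP/idP; rewrite inE.
rewrite (eq_bigl _ _ inN) [RHS](eq_bigl _ _ inN).
rewrite big_seq_cond.
rewrite (eq_bigr (fun k => \sum_(l <- lseq | Lindex b l == k)
    `|walsh_coef b f l| ^+ 2 * (psi_hat b m l : R)%:C)); last first.
  move=> k /andP[/mapP[k' _ ->] _]; rewrite sigma2_lseq => [|j]; last first.
    by rewrite tnth_mktuple -ltnS.
  by rewrite mulr_suml; apply: eq_bigr => l /eqP e; rewrite /psi_hat e.
rewrite -big_seq_cond (exchange_big_dep (fun l => l != zero_index s)) /=; last first.
  by move=> k l k0 /eqP e; rewrite -Lindex_eq0 e.
rewrite big_seq_cond [RHS]big_seq_cond; apply: eq_bigr => l /andP[/mapP[l' _ le] l0].
(* After the exchange the inner sum has the single term k = [Lindex b l], which is in [kseq] because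
   every l_j < b^m. *)
rewrite (big_rem (Lindex b l)) /=; last by apply: mem_kseq => j; rewrite le Lindex_le.
rewrite eqxx Lindex_eq0 l0 big1_seq ?addr0// => k /andP[/andP[_ /eqP <-]].
by rewrite mem_rem_uniqF// kseq_uniq.
Qed.

End IndexSums.

(** * Expectations assembled into the covariance *)

Section Covariance.
Context d (Omega : measurableType d) (R : realType) (P : probability Omega R).
Variables (b m s : nat).
Hypotheses (pb : prime b) (m1 : (1 <= m)%N).
Let b1 : (1 < b)%N. Proof. exact: prime_gt1. Qed.
Let n1 : (1 < b ^ m)%N.
Proof. by rewrite (leq_trans b1)// -[X in (X <= _)%N]expn1 leq_pexp2l// ltnW. Qed.
Local Notation C := {ffun 'I_s -> 'I_(b ^ m)}.
Local Notation mu := (tuple_lebesgue s).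
Local Notation mu2 := (tuple_lebesgue s \x tuple_lebesgue s)%E.
Local Notation T := (s.-tuple R).
Variable U : 'I_(b ^ m) -> {RV P >-> T}.
Hypothesis Ucube : forall l w, cube s (U l w).
Variable V : 'I_(b ^ m) -> T.
Hypothesis Vnet : is_net V.
Hypothesis UV : forall (l j : 'I_(b ^ m)) (i : s.-tuple nat), l != j ->
  Dset b i (V l, V j) -> uniform_on P mu2 (fun w => (U l w, U j w)) (Dset b i).
Variables I J : Omega -> 'I_(b ^ m).
Hypothesis hIJ : random_distinct_pair P (fun l w => U l w) I J.
Variable f : T -> R[i].
Hypothesis f2 : L2cube f.

Let v := netcell V.
Let F : C -> R[i] := cellint f.
Let N0 : b%:R ^+ (m * s) != 0 :> R.
Proof. by rewrite expf_neq0// b_neq0. Qed.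

(** Real and imaginary parts of f(x) f(y)^* combine products u(x) v(y) with u, v among Re f and Im
    f, so four real instances suffice. *)
Lemma Cexpectation_pair :
  Cexpectation P (fun w => f (U (I w) w) * (f (U (J w) w))^*) =
  \sum_p \sum_q (cell_density R v p q)%:C * (F p * (F q)^*).
Proof.
have [iRe iIm] := L2cube_integrable f2.
have E u u' iu iu' := @pair_expectation _ _ _ P _ _ _ pb m1 U Ucube V Vnet UV I J hIJ u u' iu iu'.
have [i1 e1] := E _ _ iRe iRe; have [i2 e2] := E _ _ iIm iIm.
have [i3 e3] := E _ _ iIm iRe; have [i4 e4] := E _ _ iRe iIm.
apply/eqP; rewrite eq_complex /=; apply/andP; split; apply/eqP.
  transitivity (\int[P]_w ( complex.Re (f (U (I w) w)) * complex.Re (f (U (J w) w))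
      + complex.Im (f (U (I w) w)) * complex.Im (f (U (J w) w)))).
    by apply: eq_Rintegral => w _; case: (f _) (f _) => [a a'] [c c'] /=; ring.
  rewrite RintegralD// e1 e2 -big_split raddf_sum; apply: eq_bigr => p _.
  rewrite -big_split raddf_sum; apply: eq_bigr => q _ /=; ring.
transitivity (\int[P]_w ( complex.Im (f (U (I w) w)) * complex.Re (f (U (J w) w))
      - complex.Re (f (U (I w) w)) * complex.Im (f (U (J w) w)))).
  by apply: eq_Rintegral => w _; case: (f _) (f _) => [a a'] [c c'] /=; ring.
rewrite RintegralB// e3 e4 -sumrB raddf_sum; apply: eq_bigr => p _.
rewrite -sumrB raddf_sum; apply: eq_bigr => q _ /=; ring.
Qed.

Let vlt l j : (v l j < b ^ m)%N. Proof. exact: netcell_lt. Qed.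
Let vne l0 l j : l0 != l -> v l0 j != v l j. Proof. exact: netcell_neq. Qed.

(** With the second function equal to 1, a row sum of the density times the cell volume remains,
    which is 1. *)
Lemma Cexpectation_fst : Cexpectation P (fun w => f (U (I w) w)) = \sum_p F p.
Proof.
have [iRe iIm] := L2cube_integrable f2.
have E u u' iu iu' := @pair_expectation _ _ _ P _ _ _ pb m1 U Ucube V Vnet UV I J hIJ u u' iu iu'.
have marg u : mu.-integrable (cube s) (EFin \o u) ->
    \int[P]_w u (U (I w) w) = \sum_(p : C) \int[mu]_(x in cellbox p) u x.
  move=> iu; have [_] := E _ _ iu (integrable_cst_cube s 1).
  under eq_Rintegral do rewrite mulr1.
  move=> ->; apply: eq_bigr => p _.
  under eq_bigr do rewrite Rintegral_cst_cell// mulrCA.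
  by rewrite -mulr_sumr -mulr_suml (sum_cell_density_r R pb vlt vne)// divff// mulr1.
apply/eqP; rewrite eq_complex /=; apply/andP; split; apply/eqP; rewrite raddf_sum.
  exact: marg iRe.
exact: marg iIm.
Qed.

Lemma Cexpectation_snd : Cexpectation P (fun w => f (U (J w) w)) = \sum_p F p.
Proof.
have [iRe iIm] := L2cube_integrable f2.
have E u u' iu iu' := @pair_expectation _ _ _ P _ _ _ pb m1 U Ucube V Vnet UV I J hIJ u u' iu iu'.
have marg u : mu.-integrable (cube s) (EFin \o u) ->
    \int[P]_w u (U (J w) w) = \sum_(p : C) \int[mu]_(x in cellbox p) u x.
  move=> iu; have [_] := E _ _ (integrable_cst_cube s 1) iu.
  under eq_Rintegral do rewrite mul1r.
  move=> ->; rewrite exchange_big; apply: eq_bigr => p _ /=.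
  under eq_bigr do rewrite Rintegral_cst_cell// mulrA (cell_density_sym R v).
  by rewrite -!mulr_suml (sum_cell_density_r R pb vlt vne)// divff// mul1r.
apply/eqP; rewrite eq_complex /=; apply/andP; split; apply/eqP; rewrite raddf_sum.
  exact: marg iRe.
exact: marg iIm.
Qed.

Lemma net_coef_psi_hatk (k : s.-tuple nat) : (forall j, tnth k j <= m)%N ->
  k != zero_index s -> net_coef v R (tnth k) = psi_hatk b m k.
Proof.
move=> km k0; apply: (net_coefE b1 vlt (netcell_count pb Vnet)) => //.
have /existsP[j jP] : [exists j, tnth k j != 0%N]; last by exists j.
rewrite -[X in is_true X]negbK negb_exists; apply: contra k0 => /forallP H.
apply/eqP/eq_from_tnth => j; rewrite tnth_mktuple; apply/eqP.
by have := H j; rewrite negbK.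
Qed.

Lemma cell_walsh_coef0 (l : C) : (forall j, l j = 0%N :> nat) -> cell_walsh_coef F l = \sum_p F p.
Proof.
move=> l0; apply: eq_bigr => p _; rewrite big1 ?rmorph1 ?mulr1// => j _.
by rewrite l0 /cell_wal big1// => i _; rewrite div0n mod0n expr0.
Qed.

(** The zero frequency carries the coefficient 1 and the squared modulus of the mean, exactly what
    the covariance subtracts. *)
Lemma covariance_lseq :
  Ccovariance P (fun w => f (U (I w) w)) (fun w => f (U (J w) w)) =
  \sum_(l <- lseq b m s | l \in [set l : s.-tuple nat | l != zero_index s])
    `|walsh_coef b f l| ^+ 2 * (psi_hat b m l : R)%:C.
Proof.
rewrite /Ccovariance Cexpectation_pair Cexpectation_fst Cexpectation_snd.
rewrite (sum_cell_density pb vlt vne).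
pose z : C := [ffun=> Ordinal (ltnW n1)].
rewrite (bigD1 z)//= net_coef0//; last by move=> j; rewrite ffunE up_log1.
rewrite cell_walsh_coef0; last by move=> j; rewrite ffunE.
rewrite sqr_normc mul1r addrAC subrr add0r.
rewrite /lseq big_map big_enum_cond.
have inN (l : C) : (l != z) = (ltuple l \in [set l : s.-tuple nat | l != zero_index s]).
  apply/idP/idP; rewrite inE; apply: contra => /eqP e; apply/eqP.
    apply: ltuple_inj; rewrite e; apply: eq_from_tnth => j.
    by rewrite !tnth_mktuple ffunE.
  by apply: eq_from_tnth => j; rewrite e !tnth_mktuple ffunE.
rewrite (eq_bigl _ _ inN); apply: eq_big => [l|l]; first by rewrite inE.
rewrite inE => l0; rewrite walsh_coef_cells// mulrC; congr (_ * _%:C).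
rewrite /psi_hat -(net_coef_psi_hatk (k := Lindex b (ltuple l))).
- by congr net_coef; apply/funext => j; rewrite !tnth_mktuple.
- by move=> j; exact: Lindex_le.
- by rewrite Lindex_eq0.
Qed.

End Covariance.

Theorem mainTheorem5 (R : realType) (d : measure_display)
    (Omega : measurableType d) (P : probability Omega R)
    (b m s : nat) (hb : prime b) (hm : (1 <= m)%N) (hs : (1 <= s)%N)
    (U : 'I_(b ^ m) -> {RV P >-> s.-tuple R})
    (hU : scrambled_net U)
    (I J : Omega -> 'I_(b ^ m))
    (hIJ : random_distinct_pair P (fun l w => U l w) I J)
    (f : s.-tuple R -> R[i]) (hf : L2cube f) :
  let cov := Ccovariance P (fun w => f (U (I w) w)) (fun w => f (U (J w) w)) in
  has_sum [set l : s.-tuple nat | l != zero_index s]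
    (fun l => `|walsh_coef b f l| ^+ 2 * (psi_hat b m l : R)%:C) cov
  /\
  has_sum [set k : s.-tuple nat | k != zero_index s]
    (fun k => sigma2 b f k * (psi_hatk b m k : R)%:C) cov.
Proof.
have b1 := prime_gt1 hb; have [Uc [V [Vnet _ UV]]] := hU.
rewrite /= (covariance_lseq hb hm Uc Vnet UV hIJ hf); split.
  apply: has_sum_finite; first exact: lseq_uniq.
  by move=> l _ nl; rewrite (psi_hat_eq0 R b1 nl) mulr0.
(* The regrouping takes place between finite sums; outside [kseq] some k_j exceeds m and the
   coefficient vanishes. *)
rewrite -sum_sigma2//; apply: has_sum_finite; first exact: kseq_uniq.
move=> k _ nk; have /existsP[j jP] : [exists j, m < tnth k j]%N.
  rewrite -[X in is_true X]negbK negb_exists; apply: contra nk => /forallP H.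
  by apply: mem_kseq => j; rewrite leqNgt.
by rewrite (psi_hatk_eq0 R b1 jP) mulr0.
Qed.
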